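(* Let $M$ and $N$ be connected locally uniformly pluri-Greenian complex manifolds, and let $\widetilde M$ and $\widetilde N$ be their pluripotential compactifications. Then any biholomorphic mapping $F:M\to N$ extends to a homeomorphism of $\widetilde M$ onto $\widetilde N$. That is, if $V$ and $U$ are norming volume forms on $M$ and $N$ respectively, so that $\widetilde M=\widetilde M_V$ and $\widetilde N=\widetilde N_U$, then there is a homeomorphism $\widetilde F:\widetilde M_V\to\widetilde N_U$ with $\widetilde F\circ\Phi_V=\Phi_U\circ F$ on $M$.
   Context: ''Negative'' means $\le 0$. Norming volume forms. For a positive continuous volume form $V$ on a connected complex manifold $M$, $L^1(M,V)$ is the Banach space of measurable functions $u$ (modulo equality a.e.) with $\|u\|_V=\int_M|u|\,dV<\infty$, and $\|u\|_{L^1(E,V)}=\int_E|u|\,dV$. $V$ is norming if for each compact set $F\subset M$ there is a constant $C(F)>0$, and for every increasing sequence of relatively compact open sets $M_j$ in $M$ with $\bigcup_j M_j=M$ there is a sequence of numbers $\varepsilon_j>0$ converging to $0$, such that for every negative plurisubharmonic function $u\not\equiv-\infty$ on $M$: (1) $\|u\|_V<\infty$; (2) $u(z)\le -C(F)\|u\|_V$ for every $z\in F$; (3) $\|u\|_{L^1(M\setminus M_j,V)}\le\varepsilon_j\|u\|_V$ for every $j$. (The constants do not depend on $u$.) Every connected complex manifold has a norming volume form. Pluricomplex Green function. For $w\in M$, $g_M(z,w)=\sup u(z)$, where the supremum is over all negative plurisubharmonic functions $u$ on $M$ such that $u(z)-\log\|z-w\|$ is bounded above near $w$ (in local coordinates);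 here $u\equiv-\infty$ is allowed as a plurisubharmonic function. It is known that $g_M(z,w)$ is plurisubharmonic in $z$. A complex manifold $M$ is locally uniformly pluri-Greenian if every point $w_0\in M$ has a coordinate neighborhood $U$ for which there are an open set $W\subset U$ containing $w_0$ and a constant $c$ such that $g_M(z,w)>\log\|z-w\|+c$ for $z\in U$ whenever $w\in W$ (norm taken in the coordinates on $U$). Pluripotential compactification. For a norming volume form $V$ on a locally uniformly pluri-Greenian $M$, let $c_V(w)=\|g_M(\cdot,w)\|_V$ and let $\Phi_V(w)=c_V(w)^{-1}g_M(\cdot,w)\in L^1(M,V)$ for $w\in M$. The pluripotential compactification $\widetilde M_V$ is the closure of $\Phi_V(M)$ in $L^1(M,V)$. Up to homeomorphism it does not depend on $V$ and is denoted by $\widetilde M$; $M$ is identified with $\Phi_V(M)$. *)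

(* Defs.v *)
From HB Require Import structures.
From mathcomp Require Import all_boot all_order all_algebra complex lra.
From mathcomp Require Import all_classical all_reals all_analysis.
From mathcomp Require Import measurable_realfun.
Set Implicit Arguments.
Unset Strict Implicit.
Unset Printing Implicit Defensive.
Import Order.TTheory GRing.Theory Num.Theory.
Import numFieldNormedType.Exports.
Local Open Scope classical_set_scope.
Local Open Scope ring_scope.

(* R[i] seen only as a numFieldType, so that 'rV[Cx R]_n is a normed module
   over the complex numbers ([complex] itself carries an R-module structure);
   [differentiable] then means complex differentiable. *)
Definition Cx (R : realType) : numFieldType := R[i].

Definition borel (T : ptopologicalType) := g_sigma_algebraType (@open T).
HB.instance Definition _ (T : ptopologicalType) := Measurable.on (borel T).

Section LebesgueCn.
Context {R : realType}.

Local Notation re := (@complex.Re R).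
Local Notation im := (@complex.Im R).

(* (v, x, y) |-> (x + i y, v) *)
Definition cvec n (p : ('rV[Cx R]_n * R) * R) : 'rV[Cx R]_n.+1 :=
  \row_i (if unlift ord0 i is Some j then p.1.1 0 j else Complex p.1.2 p.2).

Lemma cvec0 n p : @cvec n p 0 ord0 = Complex p.1.2 p.2.
Proof. by rewrite mxE unlift_none. Qed.

Lemma cvecS n p i : @cvec n p 0 (lift ord0 i) = p.1.1 0 i.
Proof. by rewrite mxE liftK. Qed.

Lemma normCx (z : Cx R) :
  `|z| = ((Num.sqrt (re z ^+ 2 + im z ^+ 2))%:C)%C.
Proof. exact: normc_def. Qed.

Lemma ReB (z w : Cx R) : re (z - w) = re z - re w.
Proof. by case: z; case: w. Qed.

Lemma ImB (z w : Cx R) : im (z - w) = im z - im w.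
Proof. by case: z; case: w. Qed.

Lemma ltCx (x : Cx R) (e : R) : (`|x| < (e%:C)%C :> Cx R) =
  (Num.sqrt (re x ^+ 2 + im x ^+ 2) < e).
Proof. by rewrite normCx ltcR. Qed.

Definition cubox n (q : {ffun 'I_n -> rat * rat}) (k : nat) : set 'rV[Cx R]_n :=
  [set z | forall i, `|re (z 0 i) - ratr (q i).1| < k.+1%:R^-1 /\
     `|im (z 0 i) - ratr (q i).2| < k.+1%:R^-1].

Lemma open_strip n (i : 'I_n) (h : Cx R -> R) (q r : R) :
  (forall x y, `|h x - h y| <=
    Num.sqrt (re (x - y) ^+ 2 + im (x - y)^+2)) ->
  open [set z : 'rV[Cx R]_n | `|h (z 0 i) - q| < r].
Proof.
move=> hL; rewrite openE => z /= zr.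
apply/nbhs_ballP; exists ((r - `|h (z 0 i) - q|)%:C)%C => /=.
  by rewrite (_ : 0 = (0%:C)%C :> Cx R)// ltcR subr_gt0.
move=> y [_ /(_ 0 i)]; rewrite /ball/= ltCx => /(le_lt_trans (hL _ _)) H.
rewrite (_ : h (y 0 i) - q = (h (z 0 i) - q) - (h (z 0 i) - h (y 0 i))); last by lra.
by rewrite (le_lt_trans (ler_normB _ _))// -ltrBrDl.
Qed.

Lemma ReL (x y : Cx R) : `|re x - re y| <=
  Num.sqrt (re (x - y) ^+ 2 + im (x - y) ^+ 2).
Proof. by rewrite -ReB -sqrtr_sqr ler_wsqrtr// lerDl sqr_ge0. Qed.

Lemma ImL (x y : Cx R) : `|im x - im y| <=
  Num.sqrt (re (x - y) ^+ 2 + im (x - y) ^+ 2).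
Proof. by rewrite -ImB -sqrtr_sqr ler_wsqrtr// lerDr sqr_ge0. Qed.

Lemma open_cubox n (U : set 'rV[Cx R]_n) : open U ->
  U = \bigcup_(qk in [set qk | cubox qk.1 qk.2 `<=` U]) cubox qk.1 qk.2.
Proof.
move=> oU; apply/seteqP; split=> [z Uz|z [qk /= sub]]; last exact: sub.
have /nbhs_ballP[e /= e0 eU] : nbhs z U by apply: open_nbhs_nbhs; split.
have [e' e'0 ee'] : exists2 e' : R, 0 < e' & e = (e'%:C)%C.
  exists (re e).
    by case: e e0 {eU} => a b /=; rewrite ltcE/= => /andP[].
  by case: e e0 {eU} => a b /=; rewrite ltcE/= => /andP[/eqP -> _].
have [k ke] : exists k : nat, k.+1%:R^-1 < e' / 4.
  have [k _ Hk] := @near_infty_natSinv_lt R (PosNum (divr_gt0 e'0 (ltr0n _ 4))).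
  by exists k; exact: (Hk k (leqnn k)).
have k0 : 0 < k.+1%:R^-1 :> R by rewrite invr_gt0.
have qx (x : R) : exists q : rat, `|x - ratr q| < k.+1%:R^-1.
  move: (_^-1) k0 => r r0.
  have [|q] := @rat_in_itvoo R (x - r) (x + r); first by lra.
  by rewrite in_itv/= => /andP[H1 H2]; exists q; rewrite ltr_distl; lra.
pose q := [ffun i => (sval (cid (qx (re (z 0 i)))),
                      sval (cid (qx (im (z 0 i)))))].
exists (q, k); last first.
  by move=> i /=; rewrite ffunE/=; split; [case: cid|case: cid].
move=> y /= yq; apply: eU; split=> // j i; rewrite ord1 /ball/= ee' ltCx.
have [] := yq i; rewrite /= ffunE/=; case: cid => /= a za; case: cid => /= b zb.
move: (_^-1) ke za zb => r ke za zb ya yb.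
have Hre : `|re (z 0 i - y 0 i)| < e' / 2.
  rewrite ReB; move: za ya ke; rewrite !ltr_norml; lra.
have Him : `|im (z 0 i - y 0 i)| < e' / 2.
  rewrite ImB; move: zb yb ke; rewrite !ltr_norml; lra.
rewrite -[ltRHS]ger0_norm ?(ltW e'0)// -sqrtr_sqr ltr_sqrt ?exprn_gt0//.
rewrite -[X in X + _]real_normK ?num_real// -[X in _ + X]real_normK ?num_real//.
move: (normr_ge0 (re (z 0 i - y 0 i))) (normr_ge0 (im (z 0 i - y 0 i))) Hre Him.
move: `|_| `|_| => u v; rewrite !expr2; nra.
Qed.

Lemma measurable_cvec n : measurable_fun [set: (borel 'rV[Cx R]_n * R) * R]
   (@cvec n : _ -> borel 'rV[Cx R]_n.+1).
Proof.
have H := (@measurability _ _ _ _ [set: (borel 'rV[Cx R]_n * R) * R]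
  (@cvec n : _ -> borel 'rV[Cx R]_n.+1) (@open 'rV[Cx R]_n.+1)).
apply: H => // _ [U oU <-].
rewrite setTI (open_cubox oU) preimage_bigcup bigcup_mkcond.
apply: countable_bigcupT_measurable => [|[q k]]; first exact: countableP.
case: ifPn => // _.
rewrite (_ : _ @^-1` _ = \bigcap_i [set p |
    `|re (cvec p 0 i) - ratr (q i).1| < k.+1%:R^-1 /\
    `|im (cvec p 0 i) - ratr (q i).2| < k.+1%:R^-1]); last first.
  by apply/seteqP; split => [p H i _|p H i]; [exact: H|exact: H].
apply: fin_bigcap_measurable => // i _.
have mB (f : (borel 'rV[Cx R]_n * R) * R -> R) a r : measurable_fun setT f ->
    measurable [set p | `|f p - a| < r].
  move=> mf; rewrite -[X in measurable X]setTI.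
  rewrite (_ : [set p | _] = (fun p => `|f p - a|) @^-1` `]-oo, r[); last first.
    by apply/seteqP; split => p /=; rewrite in_itv.
  suff mg : measurable_fun [set: (borel 'rV[Cx R]_n * R) * R] (fun p => `|f p - a|).
    exact: mg.
  by apply: measurableT_comp => //; exact: measurable_funB.
case: (unliftP ord0 i) => [j ->|->]; last first.
  under eq_fun do rewrite cvec0/=.
  apply: measurableI; apply: mB.
    by apply: measurableT_comp measurable_fst => //; exact: measurable_snd.
  exact: measurable_snd.
have mS (h : Cx R -> R) a r :
    (forall x y, `|h x - h y| <=
    Num.sqrt (re (x - y) ^+ 2 + im (x - y) ^+ 2)) ->
    measurable [set p : (borel 'rV[Cx R]_n * R) * R |
      `|h (cvec p 0 (lift ord0 j)) - a| < r].
  move=> hL; under eq_fun do rewrite cvecS/=.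
  rewrite -[X in measurable X]setTI.
  rewrite -[X in _ `&` X]/((fst \o fst) @^-1`
    [set v : borel 'rV[Cx R]_n | `|h (v 0 j) - a| < r]).
  have : measurable_fun [set: (borel 'rV[Cx R]_n * R) * R] (fst \o fst).
    exact: measurableT_comp measurable_fst measurable_fst.
  by apply => //; apply: sub_sigma_algebra; exact: open_strip.
by apply: measurableI; apply: mS => x y; [exact: ReL|exact: ImL].
Qed.

Section lebesgue_cons.
Variables (n : nat) (mu : {measure set (borel 'rV[Cx R]_n) -> \bar R}).
Local Notation leb := (@lebesgue_measure R).

Definition lebesgue_cons :=
  pushforward ((mu \x leb) \x leb)%E (@cvec n : _ -> borel 'rV[Cx R]_n.+1).

HB.instance Definition _ := Measure.copy lebesgue_cons
  (measure_function_pushforward__canonical__measure_function_Measure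
    ((mu \x leb) \x leb)%E (@measurable_cvec n)).

End lebesgue_cons.

(* Lebesgue measure on C^n = R^(2n), as an iterated product measure. *)
Fixpoint lebesgueC n : {measure set (borel 'rV[Cx R]_n) -> \bar R} :=
  match n with
  | 0 => dirac (0 : borel 'rV[Cx R]_0)
  | n'.+1 => lebesgue_cons (lebesgueC n')
  end.

End LebesgueCn.

Section L1space.
Context d (T : measurableType d) (R : realType).
Variable mu : {measure set T -> \bar R}.

Definition L1 := LspaceType1 mu.
Implicit Types f g h : L1.

HB.instance Definition _ := gen_eqMixin L1.
HB.instance Definition _ := gen_choiceMixin L1.

Local Open Scope quotient_scope.
Local Notation Q := {mfun_ mu, T >-> measurableTypeR R}.

Let mfun_measurable (q : Q) : measurable_fun [set: T] (q : T -> R).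
Proof. exact: (@measurable_funPT _ _ _ (measurableTypeR R) (repr q)). Qed.

Lemma repr_pi_ae (f : {mfun T >-> measurableTypeR R}) :
  ae_eq mu setT (repr (\pi_Q f)) f.
Proof.
have /eqmodP := reprK (\pi_Q f).
by move=> /asboolP.
Qed.

Let zeroQ : Q := \pi_Q (cst 0 : {mfun T >-> measurableTypeR R}).

Let zeroQ_finite : finite_norm mu 1 zeroQ.
Proof.
rewrite /finite_norm Lnorm1 (ae_eq_integral (cst 0%E)) ?integral0//.
- apply: measurableT_comp => //; apply/measurable_EFinP; exact: mfun_measurable.
- have := repr_pi_ae (cst 0).
  by apply: filterS => x /= H Dx; rewrite /zeroQ /aqEqMfun_to_fun H//= normr0.
Qed.

Definition L1_zero : L1 :=
  HB.pack zeroQ (isFinLebesgue.Build _ _ _ _ _ (lexx 1%E) zeroQ zeroQ_finite).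

HB.instance Definition _ := isPointed.Build L1 L1_zero.

(* the distance of the norm of L^1(mu) *)
Definition l1dist f g : R := fine (\int[mu]_x `|(f x - g x)%:E|)%E.

Lemma L1_measurable f : measurable_fun [set: T] (f : T -> R).
Proof. exact: mfun_measurable. Qed.

Lemma L1_integrable f : mu.-integrable [set: T] (fun x => (f x)%:E).
Proof.
apply/integrableP; split; first exact/measurable_EFinP/L1_measurable.
have := @Lebesgue_finite _ _ _ _ _ _ f; rewrite /finite_norm Lnorm1.
exact.
Qed.

Lemma l1distE f g : (l1dist f g)%:E = (\int[mu]_x `|(f x - g x)%:E|)%E.
Proof.
rewrite fineK// ge0_fin_numE ?integral_ge0//.
have /integrableP[_] := integrableB measurableT (L1_integrable f) (L1_integrable g).
exact.
Qed.

Let l1distxx f : l1dist f f = 0.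
Proof.
rewrite /l1dist; under eq_integral do rewrite subrr abse0.
by rewrite integral0.
Qed.

Lemma L1_eqP f g : f = g <-> ae_eq mu setT f g.
Proof.
split=> [->|]; first exact: ae_eq_refl.
case: f g => f [[pf]] [g [[pg]]] /= fg.
have fg' : f = g by rewrite -(reprK f) -(reprK g); apply/eqmodP/asboolP.
by case: _ / fg' pg fg => pg _; rewrite (Prop_irrelevance pf pg).
Qed.

Let l1dist_sep f g : l1dist f g = 0 -> f = g.
Proof.
move=> fg; apply/L1_eqP.
have /ae_eq_integral_abs H : measurable_fun setT (fun x => (f x - g x)%:E).
  by apply/measurable_EFinP; apply: measurable_funB; exact: L1_measurable.
have := l1distE f g; rewrite fg => /esym /(H mu measurableT).
by apply: filterS => x /= + Dx => /(_ Dx)[] /eqP; rewrite subr_eq0 => /eqP.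
Qed.

Let l1dist_sym f g : l1dist f g = l1dist g f.
Proof.
by congr fine; apply: eq_integral => x _; rewrite -abseN -EFinN opprB.
Qed.

Let l1dist_triangle g f h : l1dist f h <= l1dist f g + l1dist g h.
Proof.
rewrite -lee_fin EFinD !l1distE.
have mB (u v : L1) : measurable_fun setT (fun x => `|(u x - v x)%:E|%E).
  apply: measurableT_comp => //.
  by apply/measurable_EFinP; apply: measurable_funB; exact: L1_measurable.
rewrite -ge0_integralD//; apply: ge0_le_integral => //.
  by apply: emeasurable_funD; exact: mB.
move=> x _; rewrite -EFinD lee_fin.
by rewrite (_ : f x - h x = (f x - g x) + (g x - h x)) ?ler_normD// addrA subrK.
Qed.

HB.instance Definition _ := isMetric.Build R L1
  l1distxx l1dist_sep l1dist_sym l1dist_triangle.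

End L1space.

Section ComplexAnalysis.
Context {R : realType}.

Definition csqnorm (z : Cx R) : R := complex.Re z ^+ 2 + complex.Im z ^+ 2.

Definition enorm n (z : 'rV[Cx R]_n) : R :=
  Num.sqrt (\sum_(i < n) csqnorm (z 0 i)).

Definition holomorphic_on m n (D : set 'rV[Cx R]_m)
    (f : 'rV[Cx R]_m -> 'rV[Cx R]_n) :=
  forall z, D z -> differentiable f z.

Definition circle (t : R) : Cx R := Complex (cos t) (sin t).

(* Upper semicontinuous, and subharmonic (or identically -oo) along complex
   lines: sub-mean-value inequality on every closed disc contained in D. The
   function -oo is allowed. *)
Definition psh_on n (D : set 'rV[Cx R]_n) (u : 'rV[Cx R]_n -> \bar R) :=
  [/\ forall z, D z -> (u z < +oo)%E,
      forall z (a : R), D z -> (u z < a%:E)%E ->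
        \forall y \near z, (u y < a%:E)%E
    & forall z v : 'rV[Cx R]_n,
        (forall c : Cx R, `|c| <= 1 -> D (z + c *: v)) ->
        ((2 * pi)%:E * u z <=
          \int[lebesgue_measure]_(t in `[0%R, (2 * pi)%R]) u (z + circle t *: v)%R)%E].

End ComplexAnalysis.

Section Manifolds.
Context {R : realType}.

(* cmap and cinv are meaningful only on cdom and on cmap @` cdom. *)
Record chart (n : nat) (M : topologicalType) := Chart {
  cdom : set M ;
  cmap : M -> 'rV[Cx R]_n ;
  cinv : 'rV[Cx R]_n -> M ;
  cdom_open : open cdom ;
  cimg_open : open (cmap @` cdom) ;
  cmapK : {in cdom, cancel cmap cinv} ;
  cmap_continuous : {in cdom, continuous cmap} ;
  cinv_continuous : {in cmap @` cdom, continuous cinv}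
}.

Definition cimg n (M : topologicalType) (c : chart n M) := cmap c @` cdom c.

Definition compatible n (M : topologicalType) (c d : chart n M) :=
  holomorphic_on (cmap c @` (cdom c `&` cdom d)) (cmap d \o cinv c) /\
  holomorphic_on (cmap d @` (cdom c `&` cdom d)) (cmap c \o cinv d).

(* Complex manifolds of dimension n, with their maximal atlas. The base point
   of the ptopologicalType only records that the manifold is nonempty. *)
Record complexManifold (n : nat) := ComplexManifold {
  carrier :> ptopologicalType ;
  atlas : set (chart n carrier) ;
  manifold_hausdorff : hausdorff_space carrier ;
  manifold_second_countable : @second_countable carrier ;
  atlas_cover : forall x : carrier, exists2 c, atlas c & cdom c x ;
  atlas_compatible : forall c d, atlas c -> atlas d -> compatible c d ;
  atlas_maximal : forall c, (forall d, atlas d -> compatible c d) -> atlas c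
}.

Definition holomorphic m n (M : complexManifold m) (N : complexManifold n)
    (F : M -> N) :=
  continuous F /\
  forall (c : chart m M) (d : chart n N), atlas c -> atlas d ->
    holomorphic_on (cmap c @` (cdom c `&` F @^-1` cdom d))
      (cmap d \o F \o cinv c).

Definition biholomorphic m n (M : complexManifold m) (N : complexManifold n)
    (F : M -> N) :=
  exists G : N -> M,
    [/\ cancel F G, cancel G F, holomorphic F & holomorphic G].

(* A positive continuous volume form, given in each chart z of the atlas as
   vdens(z) (i/2)^n dz_1 /\ dzbar_1 /\ ... /\ dz_n /\ dzbar_n, i.e. as
   vdens(z) times the Lebesgue volume form, with the measure dV it induces:
   by vol_chart and second countability vol is determined by vdens. *)
Record volumeForm n (M : complexManifold n) := VolumeForm {
  vdens : chart n M -> 'rV[Cx R]_n -> R ;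
  vol : {measure set (borel M) -> \bar R} ;
  vdens_gt0 : forall c z, atlas c -> cimg c z -> 0 < vdens c z ;
  vdens_continuous : forall c, atlas c -> {in cimg c, continuous (vdens c)} ;
  vdens_transition : forall (c d : chart n M) (x : M),
    atlas c -> atlas d -> cdom c x -> cdom d x ->
    vdens c (cmap c x) = vdens d (cmap d x) *
      csqnorm (\det (jacobian (cmap d \o cinv c) (cmap c x))) ;
  vol_chart : forall (c : chart n M) (A : set (borel M)), atlas c ->
    measurable A -> A `<=` cdom c ->
    vol A = (\int[lebesgueC n]_(z in cmap c @` A) (vdens c z)%:E)%E
}.

Section Manifold.
Variables (n : nat) (M : complexManifold n).
Implicit Types (u : M -> \bar R) (V : volumeForm M) (z w : M).

Definition psh u :=
  forall c : chart n M, atlas c -> psh_on (cimg c) (u \o cinv c).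

Definition negative_psh u := psh u /\ forall z, (u z <= 0)%E.

Definition normV V (E : set M) u : \bar R :=
  (\int[vol V]_(z in (E : set (borel M))) `|u z|)%E.

Definition norming V :=
  [/\ forall u, negative_psh u -> (exists z, u z != -oo%E) ->
        (normV V setT u < +oo)%E,
      forall F : set M, compact F -> exists2 C : R, 0 < C &
        forall u, negative_psh u -> (exists z, u z != -oo%E) ->
        forall z, F z -> (u z <= - (C%:E * normV V setT u))%E
    & forall Mj : nat -> set M,
        (forall j, open (Mj j)) -> (forall j, compact (closure (Mj j))) ->
        (forall j, Mj j `<=` Mj j.+1) -> \bigcup_j Mj j = setT ->
        exists eps : nat -> R,
          [/\ forall j, 0 < eps j, eps @ \oo --> (0 : R)
            & forall u, negative_psh u -> (exists z, u z != -oo%E) ->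
              forall j,
                (normV V (~` Mj j) u <= (eps j)%:E * normV V setT u)%E]].

(* log ||z - w|| in the coordinates of c, equal to -oo at z = w *)
Definition log_dist (c : chart n M) z w : \bar R :=
  lne (enorm (cmap c z - cmap c w))%:E.

(* The bound does not depend on the choice of the chart around w. *)
Definition log_pole u w :=
  forall c : chart n M, atlas c -> cdom c w ->
  exists C : R, \forall z \near w, (u z <= log_dist c z w + C%:E)%E.

Definition green z w : \bar R :=
  ereal_sup [set u z | u in [set u | negative_psh u /\ log_pole u w]].

(* The strict inequality is required for z != w: at z = w both sides
   are -oo. *)
Definition locally_uniformly_pluriGreenian :=
  forall w0 : M, exists2 c : chart n M, atlas c & cdom c w0 /\
    exists W : set M, [/\ open W, W `<=` cdom c, W w0 &
      exists C : R, forall z w, cdom c z -> W w -> z != w ->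
        (log_dist c z w + C%:E < green z w)%E].

Definition cV V w : \bar R := normV V setT (green ^~ w).

(* the class in L^1(M, V) of c_V(w)^-1 g_M(., w), which is finite a.e. *)
Definition Phi V w : L1 (vol V) :=
  get [set f : L1 (vol V) |
    {ae vol V, forall z, (f z)%:E = ((cV V w)^-1 * green z w)%E}].

Definition compactification V : set (L1 (vol V)) := closure (range (Phi V)).

End Manifold.

Definition homeomorphism_onto (S T : topologicalType) (A : set S) (B : set T)
    (f : S -> T) :=
  exists g : T -> S,
    [/\ f @` A = B, {in A, cancel f g}, {within A, continuous f}
      & {within B, continuous g}].

End Manifolds.

Arguments chart R n M : clear implicits.
Arguments complexManifold R n : clear implicits.
Arguments locally_uniformly_pluriGreenian {R n} M.
Arguments compactification {R n M} V _.

(* Main.v *)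
From HB Require Import structures.
Require Import Defs.
From mathcomp Require Import all_boot all_order all_algebra complex ring lra.
From mathcomp Require Import all_classical all_reals all_analysis.
From mathcomp Require Import measurable_realfun.
Set Implicit Arguments.
Unset Strict Implicit.
Unset Printing Implicit Defensive.
Import Order.TTheory GRing.Theory Num.Theory.
Import numFieldNormedType.Exports.
Local Open Scope classical_set_scope.
Local Open Scope ring_scope.

(* Let [g w] be the pluricomplex Green function with pole [w]. A biholomorphic
   map pulls charts back to charts, so it matches the Green functions of [M] and
   [N], and it suffices to compare the normalizations of [g w] in L^1 for two
   norming volumes [V] and [V' = F^* U] on [M]. On each member of a relatively
   compact exhaustion [V] and [V'] are comparable, and the norming property
   bounds the tail of [g w] by a small multiple of its norm, uniformly in [w].
   Hence the two norms of [g w] are comparable uniformly in [w], and on the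
   closure of the normalized [g w] in L^1(V) the identity, followed by
   normalization, is continuous into L^1(V'). Doing the same with [V] and [V']
   exchanged gives the inverse, by density.
   The norming property applies to [g w] because [g w] is itself plurisubharmonic:
   a maximum principle on complex lines gives all its competitors the same
   bound [log |z - w| + C] near [w], so the upper semicontinuous regularization
   of [g w], which satisfies the sub-mean value inequality by Fatou's lemma, is
   again a competitor. *)

(** * Transfer of a normalized family between L^1 spaces *)

(** The two volumes are comparable only locally, so composition with the inverse of [F] need not map
    one L^1 space into the other. Uniform control of tails is available for the normalized Green
    functions and passes to their L^1 limits; this is why every estimate lives on their closure.
    Dividing by the new norm requires a lower bound for it there, which is the comparison of norms
    with the two volumes exchanged. For the Green function the obstacle is that each competitor has
    its own constant and its own neighbourhood in [log_pole], so their supremum has no evident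
    logarithmic bound. Only sub-mean value inequalities on discs are at hand, and [log |c|] is
    harmonic, so comparison with it gives no strict inequality at an interior maximum; adding
    [|c|^2] supplies it, at the cost of the constant [1]. Dimension zero stands apart: there the
    Green function is identically [-oo], and the norming property says nothing about it. *)

Section L1_facts.
Context d (T : measurableType d) (R : realType).
Variable mu : {measure set T -> \bar R}.

Lemma L1_intro (f : T -> R) : mu.-integrable setT (EFin \o f) ->
  exists h : L1 mu, ae_eq mu setT h f.
Proof.
move=> fi; have mf : measurable_fun setT (f : T -> measurableTypeR R).
  by apply/measurable_EFinP; exact: measurable_int fi.
pose f' : {mfun T >-> measurableTypeR R} := HB.pack f (isMeasurableFun.Build _ _ _ _ _ mf).
pose q : {mfun_ mu, T >-> measurableTypeR R} :=
  (\pi_({mfun_ mu, T >-> measurableTypeR R}) f')%qT.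
have qf : ae_eq mu setT (repr q) f by exact: (@repr_pi_ae _ _ _ mu f').
have q1 : finite_norm mu 1 q.
  rewrite /finite_norm Lnorm1.
  have /integrableP[_] := fi; congr (_ < _)%E.
  apply: ae_eq_integral => //.
  - by apply: measurableT_comp => //; exact: measurable_int fi.
  - apply: measurableT_comp => //; apply/measurable_EFinP.
    exact: (@measurable_funPT _ _ _ (measurableTypeR R) (repr q)).
  - by move: qf; apply: filterS => x /= H Dx; rewrite /aqEqMfun_to_fun H.
pose h : L1 mu := HB.pack q (isFinLebesgue.Build _ _ _ _ _ (lexx 1%E) q q1).
by exists h.
Qed.

End L1_facts.

Section measure_comparison.
Context d (T : measurableType d) (R : realType).
Variables mu nu : {measure set T -> \bar R}.

(** Domination is known only inside [E]. Extending [f] by zero and restricting both measures to [E]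
    makes it hold for all measurable sets, the form in which the integral is monotone in the
    measure. *)
Lemma ge0_le_integral_scaled_measure (k : R) (E D : set T) (f : T -> \bar R) : 0 <= k ->
  measurable E -> measurable D -> D `<=` E ->
  (forall A, measurable A -> A `<=` E -> nu A <= k%:E * mu A)%E ->
  measurable_fun D f -> (forall x, D x -> 0 <= f x)%E ->
  (\int[nu]_(x in D) f x <= k%:E * \int[mu]_(x in D) f x)%E.
Proof.
move=> k0 mE mD DE numu mf f0.
have mfD : measurable_fun setT (f \_ D) by apply/(measurable_restrictT _ mD).
have f0D x : (0 <= (f \_ D) x)%E by apply: erestrict_ge0.
have fD (m : {measure set T -> \bar R}) : (\int[m]_(x in D) f x = \int[m]_(x in D) (f \_ D) x)%E.
  by apply: eq_integral => x xD; rewrite patchT.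
have restrE (m : {measure set T -> \bar R}) :
    (\int[m]_(x in D) f x = \int[mrestr m mE]_(x in D) f x)%E.
  apply: eq_measure_integral => A mA AD; rewrite /= /mrestr setIidl//.
  exact: subset_trans AD DE.
rewrite (restrE nu) (restrE mu) (fD (mrestr nu mE)) (fD (mrestr mu mE)).
have := @ge0_integral_mscale _ _ _ (mrestr mu mE) D mD (NngNum k0) (f \_ D).
move=> <-//; last exact: measurable_funTS.
apply: ge0_le_measure_integral => // A mA.
  rewrite /mscale/= /mrestr/=; apply: numu; first exact: measurableI.
exact: subIsetr.
Qed.
End measure_comparison.

Section L1_metric.
Context d (T : measurableType d) (R : realType).
Variable mu : {measure set T -> \bar R}.
Implicit Types f g : L1 mu.

Lemma L1_closureP (A : set (L1 mu)) f : closure A f <->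
  forall e : R, 0 < e -> exists2 g, A g & l1dist f g < e.
Proof.
split=> [Af e e0|Af B /nbhs_ballP[e e0 eB]].
  by have [g [Ag]] := Af _ (nbhsx_ballx f e e0); rewrite ballEmdist; exists g.
have [g Ag fg] := Af _ e0; exists g; split => //; apply: eB.
by rewrite ballEmdist.
Qed.

Lemma L1_continuous_withinP d' (S : measurableType d') (nu : {measure set S -> \bar R})
    (A : set (L1 mu)) (F : L1 mu -> L1 nu) :
  (forall f, A f -> forall e : R, 0 < e -> exists2 r : R, 0 < r &
    forall g, A g -> l1dist f g < r -> l1dist (F f) (F g) < e) ->
  {within A, continuous F}.
Proof.
move=> AF; apply/subspace_continuousP => f Af; apply/cvg_ballP => e e0.
have [r r0 H] := AF _ Af _ e0.
rewrite near_withinE; near=> g => Ag; rewrite ballEmdist; apply: H => //.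
have: ball f r g by near: g; exact: nbhsx_ballx.
by rewrite ballEmdist.
Unshelve. all: by end_near. Qed.

Lemma measurable_L1_abs f : measurable_fun setT (fun x => `|(f x)%:E|)%E.
Proof. by apply: measurableT_comp => //; apply/measurable_EFinP/L1_measurable. Qed.

Lemma measurable_L1_abs_sub f g : measurable_fun setT (fun x => `|(f x - g x)%:E|)%E.
Proof.
by apply: measurableT_comp => //; apply/measurable_EFinP/measurable_funB;
  exact: L1_measurable.
Qed.

End L1_metric.

Section norm_comparison.
Context d (X : measurableType d) (R : realType).
Variables mu nu : {measure set X -> \bar R}.
Variables (E : nat -> set X) (K : nat -> R).
Hypothesis mE : forall j, measurable (E j).
Hypothesis ndE : nondecreasing_seq E.
Hypothesis bigE : \bigcup_j E j = setT.
Hypothesis K0 : forall j, 0 <= K j.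
Hypothesis EK : forall j A, measurable A -> A `<=` E j ->
  (nu A <= (K j)%:E * mu A)%E.

Let integral_E j D (f : X -> \bar R) : measurable D -> D `<=` E j ->
  measurable_fun D f -> (forall x, D x -> 0 <= f x)%E ->
  (\int[nu]_(x in D) f x <= (K j)%:E * \int[mu]_(x in D) f x)%E.
Proof. by move=> *; apply: (ge0_le_integral_scaled_measure (E := E j)) => // A; exact: EK. Qed.

(** A [mu]-null set is [nu]-null inside each [E j], whatever the size of [K j], and countably many
    [E j] cover the space. Equalities a.e. for [mu] can thus be used under [nu]. *)
Lemma negligible_dominated A : mu.-negligible A -> nu.-negligible A.
Proof.
move=> [B [mB muB AB]]; apply: (negligibleS AB).
rewrite -[B]setIT -bigE setI_bigcupr; apply: negligible_bigcup => j.
have mBE : measurable (B `&` E j) by exact: measurableI.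
exists (B `&` E j); split => //; apply/eqP; rewrite -measure_le0.
rewrite (le_trans (EK (j := j) mBE _))// (@subset_measure0 _ _ _ mu _ B)// mule0.
exact: lexx.
Qed.

Lemma ae_dominated (P : X -> Prop) : {ae mu, forall x, P x} -> {ae nu, forall x, P x}.
Proof. exact: negligible_dominated. Qed.

Variables (I : Type) (g : I -> X -> \bar R) (p q : I -> R).
Hypothesis mg : forall i, measurable_fun setT (g i).
Hypothesis p0 : forall i, 0 < p i.
Hypothesis q0 : forall i, 0 < q i.
Hypothesis pE : forall i, (\int[mu]_x `|g i x| = (p i)%:E)%E.
Hypothesis qE : forall i, (\int[nu]_x `|g i x| = (q i)%:E)%E.
Variable eps : nat -> R.
Hypothesis eps_cvg : eps @ \oo --> (0 : R).
Hypothesis eps_tail : forall i j,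
  (\int[nu]_(x in ~` E j) `|g i x| <= (eps j * q i)%:E)%E.

(** Take [j] with [eps j < 1 / 2]: then [q i <= K j * p i + eps j * q i], and the last term is
    absorbed on the left. The same [j] serves every [i]. The [+ 1] in the constant only makes it
    positive. *)
Lemma norm_ratio_bounded : exists2 C : R, 0 < C & forall i, q i <= C * p i.
Proof.
have [j ej] : exists j, eps j < 1 / 2.
  have /cvgrPdist_lt/(_ (1 / 2))[|n _ /(_ n (leqnn n)) /=] := eps_cvg.
    by rewrite divr_gt0.
  by rewrite sub0r normrN => H; exists n; apply: le_lt_trans H; exact: ler_norm.
exists (2 * K j + 1) => [|i]; first by rewrite ltr_pwDr// mulr_ge0.
have mgi : measurable_fun setT (fun x => `|g i x|)%E by exact: measurableT_comp.
have : (\int[nu]_x `|g i x| <= (K j * p i + eps j * q i)%:E)%E.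
  rewrite -(setUv (E j)) ge0_integral_setU//=; last 3 first.
  - exact: measurableC.
  - by rewrite setUv.
  - by rewrite disj_set2E setICr.
  rewrite EFinD leeD//.
  rewrite (le_trans (integral_E (j := j) _ _ _ _))//; first exact: measurable_funTS.
  rewrite EFinM -pE lee_wpmul2l ?lee_fin//.
  exact: ge0_subset_integral.
rewrite qE lee_fin; have := q0 i; have := p0 i; have := K0 j; nra.
Qed.

Variable Phi : I -> L1 mu.
Hypothesis PhiE : forall i,
  {ae mu, forall x, (Phi i x)%:E = ((p i)^-1%:E * g i x)%E}.

Let S := closure (range Phi).

Lemma integral_Phi_nu i D : measurable D ->
  (\int[nu]_(x in D) `|(Phi i x)%:E| = (p i)^-1%:E * \int[nu]_(x in D) `|g i x|)%E.
Proof.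
move=> mD; rewrite -ge0_integralZl_EFin ?invr_ge0 ?(ltW (p0 i))//; last first.
  by apply: measurable_funTS; exact: measurableT_comp.
apply: ge0_ae_eq_integral => //.
- by apply: measurable_funTS; exact: measurable_L1_abs.
- by apply: measurable_funeM; apply: measurable_funTS; exact: measurableT_comp.
- by move=> x _; rewrite mule_ge0// lee_fin invr_ge0 ltW.
- have := ae_dominated (PhiE i); apply: filterS => x Hx _; rewrite Hx.
  by rewrite abseM gee0_abs// lee_fin invr_ge0 ltW.
Qed.

(** Convergence in L^1 of [mu] controls [nu]-integrals only inside a fixed [E l]. The bound is
    therefore passed to the limit on [D] intersected with [E l], and monotone convergence in [l]
    then gives it on [D]. *)
Lemma closure_integral_le D c : measurable D ->
  (forall i, (\int[nu]_(x in D) `|(Phi i x)%:E| <= c%:E)%E) ->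
  forall h, S h -> (\int[nu]_(x in D) `|(h x)%:E| <= c%:E)%E.
Proof.
move=> mD Dc h /L1_closureP Sh.
have mDE l : measurable (D `&` E l) by exact: measurableI.
have DE l : (\int[nu]_(x in D `&` E l) `|(h x)%:E| <= c%:E)%E.
  apply/lee_addgt0Pr => e e0.
  have [_ [i _ <-] hi] := Sh (e / (K l + 1)) (divr_gt0 e0 (ltr_wpDl (K0 l) ltr01)).
  have -> : (c%:E + e%:E = e%:E + c%:E)%E by rewrite addeC.
  apply: (@le_trans _ _ (\int[nu]_(x in D `&` E l)
     (`|(h x - Phi i x)%:E| + `|(Phi i x)%:E|))%E).
    apply: ge0_le_integral => //.
    - by apply: measurable_funTS; exact: measurable_L1_abs.
    - apply: emeasurable_funD; apply: measurable_funTS.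
        exact: measurable_L1_abs_sub.
      exact: measurable_L1_abs.
    - move=> x _; rewrite -EFinD lee_fin -{1}(subrK (Phi i x) (h x)).
      exact: ler_normD.
  rewrite ge0_integralD//; last 2 first.
  - by apply: measurable_funTS; exact: measurable_L1_abs_sub.
  - by apply: measurable_funTS; exact: measurable_L1_abs.
  apply: leeD.
    rewrite (le_trans (integral_E (j := l) _ _ _ _))//.
      by apply: measurable_funTS; exact: measurable_L1_abs_sub.
    apply: (@le_trans _ _ ((K l)%:E * (l1dist h (Phi i))%:E)%E).
      rewrite lee_wpmul2l ?lee_fin// l1distE ge0_subset_integral//.
      exact: measurable_L1_abs_sub.
    rewrite -EFinM lee_fin.
    have K1 : 0 < K l + 1 by rewrite ltr_wpDl.
    move: hi; rewrite ltr_pdivlMr// => hi.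
    apply: le_trans (ltW hi); rewrite mulrC ler_wpM2l//.
      by rewrite -lee_fin l1distE integral_ge0.
    by rewrite lerDl.
  apply: le_trans (Dc i); apply: ge0_subset_integral => //.
  by apply: measurable_funTS; exact: measurable_L1_abs.
have -> : D = \bigcup_l (D `&` E l) by rewrite -setI_bigcupr bigE setIT.
have cvgD : (\int[nu]_(x in D `&` E l) `|(h x)%:E| @[l --> \oo] -->
    \int[nu]_(x in \bigcup_l (D `&` E l)) `|(h x)%:E|)%E.
  apply: ge0_nondecreasing_set_cvg_integral => //.
    move=> a b ab; rewrite subsetEset; apply: setIS.
    by rewrite -subsetEset; exact: ndE.
  by move=> l; apply: measurable_funTS; exact: measurable_L1_abs.
apply: (@cvge_le _ _ _ _ _ _ _ _ cvgD) => //.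
by apply: nearW.
Qed.

Lemma closure_norm_bounded : exists2 C : R, 0 < C & forall h, S h ->
  (\int[nu]_x `|(h x)%:E| <= C%:E)%E /\
  forall j, (\int[nu]_(x in ~` E j) `|(h x)%:E| <= (C * eps j)%:E)%E.
Proof.
have [C C0 qC] := norm_ratio_bounded; exists C => // h Sh.
have ratio i : (p i)^-1 * q i <= C by rewrite mulrC ler_pdivrMr.
split=> [|j].
  apply: closure_integral_le => // i.
  by rewrite integral_Phi_nu// qE -EFinM lee_fin.
have mEc : measurable (~` E j) by exact: measurableC.
apply: closure_integral_le => // i; rewrite integral_Phi_nu//.
have : (0 <= (eps j * q i)%:E)%E.
  by apply: le_trans (eps_tail i j); exact: integral_ge0.
rewrite lee_fin pmulr_lge0// => ej0.
apply: (@le_trans _ _ ((p i)^-1%:E * (eps j * q i)%:E)%E).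
  by rewrite lee_wpmul2l// lee_fin invr_ge0 ltW.
by rewrite -EFinM lee_fin mulrCA mulrC ler_wpM2r.
Qed.

(** Outside [E j] the two tails add up to at most [2 * C * eps j], made at most [e / 2] by the
    choice of [j]; inside, [nu] is at most [K j] times [mu]. Since [j] depends on neither [h] nor
    [k], [r] is uniform over [S]. *)
Lemma closure_norm_continuous (e : R) : 0 < e -> exists2 r : R, 0 < r &
  forall h k, S h -> S k -> l1dist h k < r ->
    (\int[nu]_x `|(h x - k x)%:E| <= e%:E)%E.
Proof.
move=> e0; have [C C0 SC] := closure_norm_bounded.
have [j ej] : exists j, 2 * C * eps j <= e / 2.
  have e4 : 0 < e / (4 * C) by rewrite divr_gt0// mulr_gt0.
  have /cvgrPdist_lt/(_ _ e4)[j _ /(_ j (leqnn j)) /=] := eps_cvg.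
  rewrite sub0r normrN => H; exists j.
  have {}H : eps j < e / (4 * C) by apply: le_lt_trans H; exact: ler_norm.
  by move: H; rewrite ltr_pdivlMr ?mulr_gt0//; lra.
have Kj := K0 j; exists (e / (2 * (K j + 1))) => [|h k Sh Sk hk].
  by rewrite divr_gt0// mulr_gt0// ltr_wpDl.
have mEc : measurable (~` E j) by exact: measurableC.
rewrite -(setUv (E j)) ge0_integral_setU//=; last 2 first.
- by rewrite setUv; exact: measurable_L1_abs_sub.
- by rewrite disj_set2E setICr.
have -> : e%:E = ((e / 2)%:E + (e / 2)%:E)%E by rewrite -EFinD -splitr.
apply: leeD.
  rewrite (le_trans (integral_E (j := j) _ _ _ _))//.
    by apply: measurable_funTS; exact: measurable_L1_abs_sub.
  apply: (@le_trans _ _ ((K j)%:E * (l1dist h k)%:E)%E).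
    rewrite lee_wpmul2l ?lee_fin// l1distE ge0_subset_integral//.
    exact: measurable_L1_abs_sub.
  rewrite -EFinM lee_fin; move: hk.
  have d0 : 0 <= l1dist h k by rewrite -lee_fin l1distE integral_ge0.
  rewrite ltr_pdivlMr ?mulr_gt0 ?ltr_wpDl//; nra.
apply: (@le_trans _ _ (\int[nu]_(x in ~` E j) (`|(h x)%:E| + `|(k x)%:E|))%E).
  apply: ge0_le_integral => //.
  - by apply: measurable_funTS; exact: measurable_L1_abs_sub.
  - by apply: emeasurable_funD; apply: measurable_funTS; exact: measurable_L1_abs.
  - by move=> x _; rewrite -EFinD lee_fin; exact: ler_normB.
rewrite ge0_integralD//; last 2 first.
- by apply: measurable_funTS; exact: measurable_L1_abs.
- by apply: measurable_funTS; exact: measurable_L1_abs.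
apply: (@le_trans _ _ ((C * eps j)%:E + (C * eps j)%:E)%E).
  by apply: leeD; [exact: (SC h Sh).2|exact: (SC k Sk).2].
by rewrite -EFinD lee_fin; lra.
Qed.

Variable c : R.
Hypothesis c0 : 0 < c.
Hypothesis pcq : forall i, p i <= c * q i.

(** For [Phi i] the integral is [q i / p i], at least [c^-1] by [pcq]. The bound survives in the
    closure because the [nu]-norm is continuous there. It keeps the later normalization away from
    zero. *)
Lemma closure_norm_ge h : S h -> (c^-1%:E <= \int[nu]_x `|(h x)%:E|)%E.
Proof.
move=> Sh; apply/lee_addgt0Pr => e e0.
have [r r0 Hr] := closure_norm_continuous e0.
have /L1_closureP/(_ r r0)[_ [i _ <-] hi] := Sh.
have SP : S (Phi i) by apply: subset_closure; exists i.
have := Hr _ _ Sh SP hi.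
have : (c^-1%:E <= \int[nu]_x `|(Phi i x)%:E|)%E.
  rewrite integral_Phi_nu// qE -EFinM lee_fin mulrC ler_pdivlMr//.
  by rewrite mulrC ler_pdivrMr// mulrC.
move=> /le_trans H /(leeD2l (\int[nu]_x `|(h x)%:E|)) /(le_trans _); apply.
apply: H; rewrite -ge0_integralD//; last 2 first.
- exact: measurable_L1_abs.
- exact: measurable_L1_abs_sub.
apply: ge0_le_integral => //.
- exact: measurable_L1_abs.
- by apply: emeasurable_funD; [exact: measurable_L1_abs|exact: measurable_L1_abs_sub].
- move=> x _; rewrite -EFinD lee_fin -{1}(subKr (h x) (Phi i x)).
  exact: ler_normB.
Qed.

End norm_comparison.

Section transfer.
Context d d' (X : measurableType d) (Y : measurableType d') (R : realType).
Variables (mu : {measure set X -> \bar R}) (nu : {measure set Y -> \bar R}).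
Variable G : Y -> X.
Hypothesis mG : measurable_fun setT G.
Variables (E : nat -> set X) (K : nat -> R).
Hypothesis mE : forall j, measurable (E j).
Hypothesis ndE : nondecreasing_seq E.
Hypothesis bigE : \bigcup_j E j = setT.
Hypothesis K0 : forall j, 0 <= K j.
Hypothesis EK : forall j A, measurable A -> A `<=` E j ->
  (nu (G @^-1` A) <= (K j)%:E * mu A)%E.
Variables (I : Type) (g : I -> X -> \bar R) (p q : I -> R).
Hypothesis mg : forall i, measurable_fun setT (g i).
Hypothesis p0 : forall i, 0 < p i.
Hypothesis q0 : forall i, 0 < q i.
Hypothesis pE : forall i, (\int[mu]_x `|g i x| = (p i)%:E)%E.
Hypothesis qE : forall i, (\int[nu]_y `|g i (G y)| = (q i)%:E)%E.
Variable eps : nat -> R.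
Hypothesis eps_cvg : eps @ \oo --> (0 : R).
Hypothesis eps_tail : forall i j,
  (\int[nu]_(y in ~` (G @^-1` E j)) `|g i (G y)| <= (eps j * q i)%:E)%E.
Variable c : R.
Hypothesis c0 : 0 < c.
Hypothesis pcq : forall i, p i <= c * q i.
Variables (Phi : I -> L1 mu) (Psi : I -> L1 nu).
Hypothesis PhiE : forall i,
  {ae mu, forall x, (Phi i x)%:E = ((p i)^-1%:E * g i x)%E}.
Hypothesis PsiE : forall i,
  {ae nu, forall y, (Psi i y)%:E = ((q i)^-1%:E * g i (G y))%E}.

(** Moving [nu] to [X] along [G] puts both measures on one space, where the preceding comparison
    applies. *)
Let nuG : {measure set X -> \bar R} :=
  measure_function_pushforward__canonical__measure_function_Measure nu mG.

Let EK' j A : measurable A -> A `<=` E j -> (nuG A <= (K j)%:E * mu A)%E.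
Proof. exact: EK. Qed.

Let integral_nuG D (f : X -> \bar R) : measurable D ->
  measurable_fun setT f -> (forall x, 0 <= f x)%E ->
  (\int[nuG]_(x in D) f x = \int[nu]_(y in G @^-1` D) f (G y))%E.
Proof.
move=> mD mf f0; rewrite (ge0_integral_pushforward mG)//.
by apply: measurable_funTS.
Qed.

Let qE' i : (\int[nuG]_x `|g i x| = (q i)%:E)%E.
Proof. by rewrite integral_nuG// ?qE//; exact: measurableT_comp. Qed.

Let eps_tail' i j : (\int[nuG]_(x in ~` E j) `|g i x| <= (eps j * q i)%:E)%E.
Proof.
rewrite integral_nuG//; first exact: eps_tail.
  exact: measurableC.
exact: measurableT_comp.
Qed.

Let S := closure (range Phi).

Let bounded := closure_norm_bounded mE ndE bigE K0 EK' mg p0 q0 pE qE' eps_cvg eps_tail' PhiE.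
Let cont := closure_norm_continuous mE ndE bigE K0 EK' mg p0 q0 pE qE' eps_cvg eps_tail' PhiE.
Let norm_ge := closure_norm_ge mE ndE bigE K0 EK' mg p0 q0 pE qE' eps_cvg eps_tail' PhiE c0 pcq.

Let N (h : L1 mu) : R := fine (\int[nuG]_x `|(h x)%:E|)%E.

Let NE h : S h -> (\int[nuG]_x `|(h x)%:E| = (N h)%:E)%E.
Proof.
move=> Sh; have [C C0 /(_ h Sh)[hC _]] := bounded.
by rewrite fineK// ge0_fin_numE ?integral_ge0// (le_lt_trans hC)// ltry.
Qed.

Let N_ge h : S h -> c^-1 <= N h.
Proof. by move=> Sh; rewrite -lee_fin -NE//; exact: norm_ge. Qed.

Let N_gt0 h : S h -> 0 < N h.
Proof. by move=> /N_ge; apply: lt_le_trans; rewrite invr_gt0. Qed.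

(** The extension: compose with [G], then divide by the norm. The quotient is shown to be integrable
    on [S]; elsewhere [get] may return its default value. *)
Let T (h : L1 mu) : L1 nu :=
  get [set k : L1 nu | ae_eq nu setT k (fun y => h (G y) / N h)].

Let measurable_comp (h : L1 mu) : measurable_fun setT (fun y => h (G y)).
Proof. by apply: (measurableT_comp (f := h : X -> R)); [exact: L1_measurable|exact: mG]. Qed.

Let TE h : S h -> ae_eq nu setT (T h) (fun y => h (G y) / N h).
Proof.
move=> Sh; apply: (@getPex _ [set k : L1 nu | ae_eq nu setT k (fun y => h (G y) / N h)]).
apply: L1_intro; apply/integrableP; split.
  apply/measurable_EFinP; apply: measurable_funM => //.
  exact: measurable_comp.
have Nh := N_gt0 Sh.
rewrite (eq_integral (fun y => ((N h)^-1%:E * `|(h (G y))%:E|)%E)); last first.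
  by move=> y _ /=; rewrite normrM normfV (ger0_norm (ltW Nh)) mulrC EFinM.
rewrite ge0_integralZl_EFin ?invr_ge0 ?(ltW Nh)//; last first.
  by apply: measurableT_comp => //; apply/measurable_EFinP; exact: measurable_comp.
have := NE Sh; rewrite integral_nuG//; last exact: measurable_L1_abs.
by rewrite preimage_setT => ->; rewrite -EFinM ltry.
Qed.

Lemma transfer_exists : exists T : L1 mu -> L1 nu,
  {within closure (range Phi), continuous T} /\ forall i, T (Phi i) = Psi i.
Proof.
exists T; split.
  apply: L1_continuous_withinP => f Sf e e0.
  have Nf := N_gt0 Sf.
  (* With [D] the [nuG]-distance of [f] and [k], the normalized functions differ by at most
     [2 * D / N f]: one [D / N f] comes from the numerators, one from the norms, as
     [|N k - N f| <= D]. The tolerance [e / 4 * N f] makes this at most [e / 2]. *)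
  have [r r0 H] := @cont (e / 4 * N f) (mulr_gt0 (divr_gt0 e0 (ltr0n _ 4)) Nf).
  exists r => // k Sk fk; have {}H := H _ _ Sf Sk fk.
  have Nk := N_gt0 Sk.
  set D := fine (\int[nuG]_x `|(f x - k x)%:E|)%E.
  have DE : (\int[nuG]_x `|(f x - k x)%:E| = D%:E)%E.
    by rewrite fineK// ge0_fin_numE ?integral_ge0// (le_lt_trans H)// ltry.
  have NN : `|N k - N f| <= D.
    have tri (u v : L1 mu) : S u -> S v -> (\int[nuG]_x `|(u x - v x)%:E| = D%:E)%E ->
        N u <= N v + D.
      move=> Su Sv uvD; rewrite -lee_fin EFinD -!NE// -uvD -ge0_integralD//; last 2 first.
      - exact: measurable_L1_abs.
      - exact: measurable_L1_abs_sub.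
      apply: ge0_le_integral => //.
      - exact: measurable_L1_abs.
      - by apply: emeasurable_funD; [exact: measurable_L1_abs|exact: measurable_L1_abs_sub].
      - move=> x _; rewrite -EFinD lee_fin.
        by rewrite -{1}(subrK (v x) (u x)) addrC ler_normD.
    have := tri _ _ Sf Sk DE.
    have : N k <= N f + D.
      apply: tri => //; rewrite -DE; apply: eq_integral => x _.
      by rewrite -abseN -EFinN opprB.
    by rewrite ler_norml; lra.
  rewrite -lte_fin l1distE.
  have -> : (\int[nu]_y `|(T f y - T k y)%:E| =
      \int[nu]_y `|(f (G y) / N f - k (G y) / N k)%:E|)%E.
    apply: ge0_ae_eq_integral => //.
    - exact: measurable_L1_abs_sub.
    - apply: measurableT_comp => //; apply/measurable_EFinP.
      by apply: measurable_funB; apply: measurable_funM => //; exact: measurable_comp.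
    - have := TE Sf; have := TE Sk; apply: filterS2 => y H1 H2 _.
      by rewrite H1// H2.
  apply: (@le_lt_trans _ _ (\int[nu]_y ((N f)^-1%:E * `|(f (G y) - k (G y))%:E| +
      (D / (N f * N k))%:E * `|(k (G y))%:E|))%E).
    apply: ge0_le_integral => //.
    - apply: measurableT_comp => //; apply/measurable_EFinP.
      by apply: measurable_funB; apply: measurable_funM => //; exact: measurable_comp.
    - apply: emeasurable_funD; apply: measurable_funeM; apply: measurableT_comp => //; apply/measurable_EFinP => //.
        by apply: measurable_funB; exact: measurable_comp.
      exact: measurable_comp.
    - move=> y _; rewrite -!EFinM -EFinD lee_fin.
      have -> : f (G y) / N f - k (G y) / N k =
        (N f)^-1 * (f (G y) - k (G y)) + (N k - N f) / (N f * N k) * k (G y).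
        by field; rewrite !gt_eqF.
      apply: le_trans (ler_normD _ _) _; rewrite !normrM !normfV normrM.
      rewrite (ger0_norm (ltW Nf)) (ger0_norm (ltW Nk)) lerD2l.
      by rewrite ler_wpM2r// ler_wpM2r// invr_ge0 mulr_ge0// ltW.
  have mfk : measurable_fun setT (fun y => `|(f (G y) - k (G y))%:E|)%E.
    by apply: measurableT_comp => //; apply/measurable_EFinP; apply: measurable_funB; exact: measurable_comp.
  have mk : measurable_fun setT (fun y => `|(k (G y))%:E|)%E.
    by apply: measurableT_comp => //; apply/measurable_EFinP; exact: measurable_comp.
  have D0 : 0 <= D by apply: le_trans NN.
  rewrite ge0_integralD//; last 4 first.
  - by move=> y _; rewrite mule_ge0// lee_fin invr_ge0 ltW.
  - exact: measurable_funeM.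
  - by move=> y _; rewrite mule_ge0// lee_fin divr_ge0// mulr_ge0// ltW.
  - exact: measurable_funeM.
  rewrite !ge0_integralZl_EFin ?invr_ge0 ?(ltW Nf) ?divr_ge0 ?mulr_ge0 ?(ltW Nk) ?(ltW Nf)//.
  have := DE; rewrite integral_nuG//; last exact: measurable_L1_abs_sub.
  rewrite preimage_setT => ->.
  have := NE Sk; rewrite integral_nuG//; last exact: measurable_L1_abs.
  rewrite preimage_setT => ->.
  rewrite -!EFinM -EFinD lte_fin.
  have De : D <= e / 4 * N f by rewrite -lee_fin -DE.
  have -> : (N f)^-1 * D + D / (N f * N k) * N k = 2 * D / N f.
    by field; rewrite !gt_eqF.
  rewrite ltr_pdivrMr//; nra.
move=> i; apply/L1_eqP.
have SP : S (Phi i) by apply: subset_closure; exists i.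
have Ni : N (Phi i) = q i / p i.
  apply: EFin_inj; rewrite -NE// (integral_Phi_nu mE bigE EK' mg p0 PhiE)//.
  by rewrite qE' -EFinM mulrC.
have PhiG : {ae nu, forall y, (Phi i (G y))%:E = ((p i)^-1%:E * g i (G y))%E}.
  have [B [mB B0 HB]] := ae_dominated (nu := nuG) mE bigE EK' (PhiE i).
  exists (G @^-1` B); split => //; first by rewrite -[X in measurable X]setTI; exact: mG.
  by move=> y /= Hy; apply: HB.
have := TE SP; have := PsiE i; move: PhiG; apply: filterS3 => y H1 H2 H3 _.
rewrite H3// Ni; apply: EFin_inj; rewrite H2 invf_div EFinM H1 muleC muleA -EFinM.
by congr (_%:E * _)%E; field; rewrite !gt_eqF.
Qed.

End transfer.

(** Continuity of [g] is only relative to [closure B], so [f] must first be seen to carry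
    [closure A] into it ([stable]). Then [g \o f] and the identity agree on the dense part [A],
    hence on [closure A] by the Hausdorff property ([cancels]). *)
Lemma closure_homeomorphism (X Y : topologicalType) (A : set X) (B : set Y)
    (f : X -> Y) (g : Y -> X) : hausdorff_space X -> hausdorff_space Y ->
  {within closure A, continuous f} -> {within closure B, continuous g} ->
  (forall x, A x -> B (f x) /\ g (f x) = x) ->
  (forall y, B y -> A (g y) /\ f (g y) = y) ->
  homeomorphism_onto (closure A) (closure B) f.
Proof.
have stable (X' Y' : topologicalType) (A' : set X') (B' : set Y') (f' : X' -> Y') x :
    {within closure A', continuous f'} -> (forall x, A' x -> B' (f' x)) ->
    closure A' x -> closure B' (f' x).
  move=> /subspace_continuousP cf AB Ax O Ofx.
  have : within (closure A') (nbhs x) (f' @^-1` O) by exact: cf.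
  rewrite /within/= => /Ax[z [Az Oz]]; exists (f' z); split; first exact: AB.
  by apply: Oz; exact: subset_closure.
have cancels (X' Y' : topologicalType) (A' : set X') (B' : set Y') (f' : X' -> Y')
    (g' : Y' -> X') x : hausdorff_space X' ->
    {within closure A', continuous f'} -> {within closure B', continuous g'} ->
    (forall x, A' x -> B' (f' x) /\ g' (f' x) = x) ->
    closure A' x -> g' (f' x) = x.
  move=> hX cf cg AB Ax; apply: hX => O O' Ogf O'x.
  have Bfx : closure B' (f' x) by apply: (stable _ _ A' B') => // z /AB[].
  move/subspace_continuousP : cf => /(_ x Ax).
  move/subspace_continuousP : cg => /(_ _ Bfx) /(_ _ Ogf) /= gO.
  move=> /(_ _ gO) /= fO.
  have {}fO : nbhs x [set z | closure A' z -> closure B' (f' z) -> O (g' (f' z))].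
    exact: fO.
  have [z [Az [Oz O'z]]] := Ax _ (filterI fO O'x).
  exists z; split => //; have [Bz gz] := AB _ Az; rewrite -gz.
  by apply: Oz; exact: subset_closure.
move=> hX hY cf cg AB BA; exists g; split => //.
- apply/seteqP; split => [_ [x Ax <-]|y By].
    by apply: (stable _ _ A B) => // z /AB[].
  exists (g y); first by apply: (stable _ _ B A) => // z /BA[].
  exact: (cancels _ _ B A g f y hY cg cf BA By).
- by move=> x; rewrite inE => Ax; exact: (cancels _ _ A B f g x hX cf cg AB Ax).
Qed.

(** * A maximum principle on complex lines *)

Section real_facts.
Context {R : realType}.

(** The right side minus the left has derivative [p^3 / (1 + p)], of the sign of [p], and vanishes
    at [p = 0]. The expansion goes to third order because the second-order terms must be kept
    exactly: they cancel when averaged over a circle. *)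
Lemma ln1D_le_taylor3 (p : R) : -1 < p -> ln (1 + p) <= p - p ^+ 2 / 2 + p ^+ 3 / 3.
Proof.
move=> p1; pose f (y : R) : R := (y - 1) - (y - 1) ^+ 2 / 2 + (y - 1) ^+ 3 / 3 - ln y.
have df (y : R) : 0 < y -> is_derive y 1 f ((y - 1) ^+ 3 / y).
  move=> y0; have lny := is_derive1_ln y0; apply: is_derive_eq.
  rewrite /GRing.scale/=; field; exact: lt0r_neq0.
have f1 : f 1 = 0 by rewrite /f ln1; ring.
have cf a b : 0 < a -> {within `[a, b], continuous f}.
  move=> a0; apply: continuous_in_subspaceT => x; rewrite inE/= in_itv/= => /andP[ax _].
  apply/differentiable_continuous/derivable1_diffP.
  by have [] := df x (lt_le_trans a0 ax).
suff : 0 <= f (1 + p) by rewrite /f; move: (ln _) => l; rewrite !expr2 !exprS expr0; lra.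
have [p0|p0|->] := ltgtP p 0; last by rewrite addr0 f1.
- have p1' : 1 + p < 1 by lra.
  have [x||c] := MVT (df := fun y => (y - 1) ^+ 3 / y) p1' _ (cf _ _ _).
  + by rewrite in_itv/= => /andP[x1 _]; apply: df; lra.
  + by lra.
  rewrite in_itv/= => /andP[c1 c2]; rewrite f1 sub0r => fp.
  rewrite -oppr_le0 fp nmulr_rle0.
    by lra.
  rewrite pmulr_llt0 ?invr_gt0; last by lra.
  by rewrite exprn_odd_lt0//; lra.
- have p1' : 1 < 1 + p by lra.
  have [x||c] := MVT (df := fun y => (y - 1) ^+ 3 / y) p1' _ (cf _ _ _).
  + by rewrite in_itv/= => /andP[x1 _]; apply: df; lra.
  + by lra.
  rewrite in_itv/= => /andP[c1 c2]; rewrite f1 subr0 => ->.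
  by rewrite mulr_ge0 ?divr_ge0 ?exprn_ge0//; lra.
Qed.

Lemma integral_circle_poly (a b c : R) :
  (\int[lebesgue_measure]_(t in `[0%R, (2 * pi)%R]) (a + b * cos t + c * cos t ^+ 2)%:E =
   (2 * pi * a + pi * c)%:E)%E.
Proof.
have pi0 := pi_gt0 R.
pose F t : R := a * t + b * sin t + c / 2 * (t + sin t * cos t).
have dF (t : R) : is_derive t 1 F (a + b * cos t + c * cos t ^+ 2).
  apply: is_derive_eq; rewrite /GRing.scale/=.
  have := cos2Dsin2 t; move: (cos t) (sin t) => x y xy.
  have -> : y * - y = x ^+ 2 - 1 by rewrite -xy; ring.
  by field.
rewrite (@continuous_FTC2 _ _ F)//.
- rewrite /F sin0 cos0 -EFinB; congr _%:E.
  have -> : sin (2 * pi) = 0 :> R by rewrite mulr_natl sin2pi.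
  have -> : cos (2 * pi) = 1 :> R by rewrite mulr_natl cos2pi.
  by field.
- by rewrite mulr_gt0.
- apply: continuous_subspaceT => t.
  by apply: differentiable_continuous; apply/derivable1_diffP.
- have cF (t : R) : {for t, continuous F}.
    by apply/differentiable_continuous/derivable1_diffP; have [] := dF t.
  split=> [t _||]; first by have [] := dF t.
  + exact: cvg_at_right_filter (cF _).
  + exact: cvg_at_left_filter (cF _).
- by move=> t _; rewrite derive1E; have [_ ->] := dF t.
Qed.

End real_facts.

Section complex_plane.
Context {R : realType}.

Lemma csqnorm_ge0 (z : Cx R) : 0 <= csqnorm z.
Proof. by rewrite addr_ge0 ?sqr_ge0. Qed.

Lemma normCxE (z : Cx R) : `|z| = ((Num.sqrt (csqnorm z))%:C)%C.
Proof. exact: normCx. Qed.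

Lemma csqnormM (z w : Cx R) : csqnorm (z * w) = csqnorm z * csqnorm w.
Proof. by case: z => a b; case: w => c d; rewrite /csqnorm /=; ring. Qed.

Lemma csqnorm_eq0 (z : Cx R) : csqnorm z = 0 -> z = 0.
Proof.
case: z => a b; rewrite /csqnorm/= => /eqP; rewrite paddr_eq0 ?sqr_ge0//.
by rewrite !sqrf_eq0 => /andP[/eqP -> /eqP ->].
Qed.

Lemma normCx_le1 (z : Cx R) : (`|z| <= 1) = (csqnorm z <= 1).
Proof.
rewrite normCxE (_ : 1 = (1%:C)%C :> Cx R)// lecR -{1}sqrtr1 ler_psqrt// ?nnegrE//.
exact: csqnorm_ge0.
Qed.

Lemma csqnorm_circle (t : R) : csqnorm (circle t) = 1.
Proof. exact: cos2Dsin2. Qed.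

Lemma Cx_posP (e : Cx R) : 0 < e -> exists2 r : R, 0 < r & e = (r%:C)%C.
Proof.
case: e => a b; rewrite ltcE/= => /andP[/eqP -> a0]; by exists a.
Qed.

Lemma cvg_Complex (T : Type) (F : set_system T) {FF : Filter F} (f g : T -> R) (a b : R) :
  f @ F --> a -> g @ F --> b ->
  (fun t => Complex (f t) (g t) : Cx R) @ F --> (Complex a b : Cx R).
Proof.
move=> fa gb; apply/cvgrPdist_lt => e /Cx_posP[r r0 ->].
have r2 : 0 < r / 2 by rewrite divr_gt0.
move/cvgrPdist_lt : fa => /(_ _ r2) fa; move/cvgrPdist_lt : gb => /(_ _ r2) gb.
near=> t; rewrite ltCx.
have ft : `|a - f t| < r / 2 by near: t.
have gt : `|b - g t| < r / 2 by near: t.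
rewrite -[ltRHS]ger0_norm ?(ltW r0)// -sqrtr_sqr ltr_sqrt ?exprn_gt0//=.
rewrite -[X in X + _]real_normK ?num_real// -[X in _ + X]real_normK ?num_real//.
move: (normr_ge0 (a - f t)) (normr_ge0 (b - g t)) ft gt.
move: `|_| `|_| => x y; rewrite !expr2; nra.
Unshelve. all: by end_near. Qed.

Lemma continuous_circle : continuous (@circle R).
Proof. by move=> t; apply: cvg_Complex; [exact: continuous_cos|exact: continuous_sin]. Qed.

Lemma Cx_Re_continuous : continuous (fun z : Cx R => complex.Re z).
Proof.
move=> z; apply/(@cvgrPdist_lt _ _ _ (nbhs z) (nbhs_filter z)) => e e0.
have eC : 0 < (e%:C)%C :> Cx R by rewrite (_ : 0 = (0%:C)%C :> Cx R)// ltcR.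
apply/nbhs_ballP; exists (e%:C)%C => // y; rewrite /ball/= ltCx.
by apply: le_lt_trans; exact: ReL.
Qed.

Lemma Cx_Im_continuous : continuous (fun z : Cx R => complex.Im z).
Proof.
move=> z; apply/(@cvgrPdist_lt _ _ _ (nbhs z) (nbhs_filter z)) => e e0.
have eC : 0 < (e%:C)%C :> Cx R by rewrite (_ : 0 = (0%:C)%C :> Cx R)// ltcR.
apply/nbhs_ballP; exists (e%:C)%C => // y; rewrite /ball/= ltCx.
by apply: le_lt_trans; exact: ImL.
Qed.

Lemma cvg_sqrD (T : Type) (F : set_system T) {FF : Filter F} (f g : T -> R) (a b : R) :
  f @ F --> a -> g @ F --> b -> (fun t => f t ^+ 2 + g t ^+ 2) @ F --> a ^+ 2 + b ^+ 2.
Proof. by move=> fa gb; apply: cvgD; apply: cvgM. Qed.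

Lemma csqnorm_continuous : continuous (@csqnorm R).
Proof.
rewrite /csqnorm => z.
have Rez := @Cx_Re_continuous z; have Imz := @Cx_Im_continuous z.
have := @cvg_sqrD _ (nbhs z) (nbhs_filter z) _ _ _ _  Rez Imz.
exact.
Qed.

Lemma cvg_line n (T : Type) (F : set_system T) {FF : Filter F} (f : T -> Cx R)
    (g : T -> 'rV[Cx R]_n) (a : Cx R) (z v : 'rV[Cx R]_n) :
  f @ F --> a -> g @ F --> z -> (fun t => g t + f t *: v) @ F --> z + a *: v.
Proof.
move=> fa gz; have H := @cvgZr_tmp _ _ _ _ FF _ _ v fa.
exact: (@cvgD _ _ _ _ FF _ _ _ _ gz H).
Qed.

End complex_plane.

Section upper_semicontinuity.
Context {R : realType}.

Lemma lte_fin_between (x : \bar R) (a : R) : (x < a%:E)%E ->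
  exists2 c : R, c < a & (x < c%:E)%E.
Proof.
case: x => [r||]//; last by exists (a - 1); rewrite ?ltNyr// gtrBl.
by rewrite lte_fin => ra; exists ((r + a) / 2); rewrite ?lte_fin midf_lt.
Qed.

(** The bound [B] and a point above [-oo] make the supremum real. If it were not attained, each
    point of [K] would have a neighbourhood where [f] stays below some smaller level. Compactness,
    applied along the filter of levels tending to the supremum from the left, gives one such level
    for all of [K]. *)
Lemma usc_compact_max (T : topologicalType) (K : set T) (f : T -> \bar R) (B : R) :
  compact K -> (forall x, K x -> f x <= B%:E)%E -> (exists2 x, K x & -oo < f x)%E ->
  (forall x (a : R), K x -> f x < a%:E -> \forall y \near x, K y -> f y < a%:E)%E ->
  exists2 x, K x & forall y, K y -> (f y <= f x)%E.
Proof.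
move=> cK fB [x0 Kx0 fx0] fusc; apply: contrapT => nomax.
set S := ereal_sup (f @` K).
have SB : (S <= B%:E)%E by apply: ge_ereal_sup => _ [x Kx <-]; exact: fB.
have xS x : K x -> (f x <= S)%E by move=> Kx; apply: ereal_sup_ubound; exists x.
have Sfin : S \is a fin_num.
  rewrite fin_numE gt_eqF ?(lt_le_trans fx0 (xS _ Kx0))// lt_eqF//.
  by rewrite (le_lt_trans SB)// ltry.
have ltS x : K x -> (f x < (fine S)%:E)%E.
  move=> Kx; rewrite lt_neqAle fineK// xS// andbT; apply/eqP => fS.
  by apply: nomax; exists x => // y Ky; rewrite fS xS.
have /compact_near_coveringP/near_covering_withinP cov := cK.
have : \forall a \near (fine S)^'-, forall y, K y -> (f y < a%:E)%E.
  apply: (cov R ((fine S)^'-) (fun a y => (f y < a%:E)%E)) => x Kx.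
  have [c cS fxc] := lte_fin_between (ltS _ Kx).
  near=> y a.
  have yc : K y -> (f y < c%:E)%E by near: y; exact: fusc.
  have ca : c < a by near: a; exact: nbhs_left_gt.
  by move=> /yc /lt_trans; apply; rewrite lte_fin.
move=> Sa; have [a [/= aS Ka]] : exists a, a < fine S /\ forall y, K y -> (f y < a%:E)%E.
  have H : \forall a \near (fine S)^'-, a < fine S /\ forall y, K y -> (f y < a%:E)%E.
    by near=> a; split; near: a => //; exact: nbhs_left_lt.
  by have [a] := filter_ex H; exists a.
have : (S <= a%:E)%E by apply: ge_ereal_sup => _ [x Kx <-]; exact/ltW/Ka.
by rewrite leNgt -(fineK Sfin) lte_fin aS.
Unshelve. all: by end_near. Qed.

End upper_semicontinuity.

Section psh_on_lines.
Context {R : realType} (n : nat).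
Implicit Types (D : set 'rV[Cx R]_n) (u : 'rV[Cx R]_n -> \bar R).

Lemma usc_on_measurable_comp D u (c : R -> 'rV[Cx R]_n) :
  (forall z (a : R), D z -> (u z < a%:E)%E -> \forall y \near z, (u y < a%:E)%E) ->
  continuous c -> (forall t, D (c t)) -> measurable_fun setT (u \o c).
Proof.
move=> uusc cc Dc.
rewrite (_ : u \o c = \- (\- (u \o c)))%E; last first.
  by apply/funext => t /=; rewrite oppeK.
apply: measurableT_comp => //; apply: lower_semicontinuous_measurable => t a /= au.
have : \forall y \near c t, (u y < (- a)%:E)%E.
  by apply: uusc => //; rewrite EFinN lteNr.
move=> /(cc t) H; exists [set s | (u (c s) < (- a)%:E)%E]; first exact: H.
by move=> s /=; rewrite EFinN lteNr.
Qed.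

Lemma continuous_circle_line (z v : 'rV[Cx R]_n) : continuous (fun t : R => z + circle t *: v).
Proof.
move=> t; apply: (@cvg_line _ _ _ (nbhs t) (nbhs_filter t) _ (fun=> z) (circle t) z v).
  exact: continuous_circle.
exact: cvg_cst.
Qed.

Lemma circle_le1 (t : R) : `|circle t : Cx R| <= 1.
Proof. by rewrite normCx_le1 csqnorm_circle. Qed.

(** Comparing the integrals needs [u] integrable on the circle. The sub-mean value inequality itself
    provides this: as [u <= 0], the integral of [|u|] is at most [- (2 * pi) * u z], which is
    finite. *)
Lemma psh_le_circle_poly D u (z v : 'rV[Cx R]_n) (A B C : R) : psh_on D u ->
  (forall x, D x -> u x <= 0)%E ->
  (forall c : Cx R, `|c| <= 1 -> D (z + c *: v)) -> (-oo < u z)%E ->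
  (forall t, u (z + circle t *: v)%R <= (A + B * cos t + C * cos t ^+ 2)%:E)%E ->
  ((2 * pi)%:E * u z <= (2 * pi * A + pi * C)%:E)%E.
Proof.
move=> pu u0 Dzv uz uP; have [_ uusc mean] := pu.
apply: (le_trans (mean _ _ Dzv)); rewrite -(integral_circle_poly A B C).
have uc0 t : (u (z + circle t *: v)%R <= 0)%E by apply: u0; apply: Dzv; exact: circle_le1.
have mu : measurable_fun setT (fun t : R => u (z + circle t *: v)).
  apply: (usc_on_measurable_comp uusc); first exact: continuous_circle_line.
  by move=> t; apply: Dzv; exact: circle_le1.
have cP : continuous (fun t : R => A + B * cos t + C * cos t ^+ 2).
  move=> t; apply/differentiable_continuous/derivable1_diffP.
  by [].
apply: le_integral => //.
- apply/integrableP; split; first exact: measurable_funTS.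
  under eq_integral do rewrite lee0_abs ?uc0//.
  set I := integral _ _ _.
  have : ((2 * pi)%:E * u z <= - I)%E.
    apply: (le_trans (mean _ _ Dzv)).
    rewrite /I -integral_ge0N; last by move=> t _; rewrite oppe_ge0.
    by under [leRHS]eq_integral do rewrite oppeK.
  rewrite leeNr => /le_lt_trans; apply.
  have uz0 : (u z <= 0)%E.
    by apply: u0; have := Dzv 0; rewrite normr0 scale0r addr0; apply; exact: ler01.
  move: uz uz0; by case: (u z) => [r||]// _ _; rewrite -EFinM -EFinN ltry.
- apply: continuous_compact_integrable; first exact: segment_compact.
  exact: continuous_subspaceT.
Qed.

Lemma compact_annulus (a b : R) :
  compact [set p : R * R | a <= p.1 ^+ 2 + p.2 ^+ 2 <= b].
Proof.
have cq : continuous (fun p : R * R => p.1 ^+ 2 + p.2 ^+ 2).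
  move=> p; apply: (@cvg_sqrD _ _ (nbhs p) (nbhs_filter p)).
    exact: cvg_fst.
  exact: cvg_snd.
(* With [c >= 1] one has [b <= c <= c^2], so both coordinates are bounded by [c]. *)
pose c := Num.max 1 b.
apply: (@subclosed_compact _ _ (`[- c, c] `*` `[- c, c])).
- rewrite (_ : mkset _ = (fun p : R * R => p.1 ^+ 2 + p.2 ^+ 2) @^-1` `[a, b]).
    by apply: closed_comp; [move=> p _; exact: cq|exact: itv_closed].
  by apply/seteqP; split => p /=; rewrite in_itv.
- by apply: compact_setX; exact: segment_compact.
- move=> [x y] /= /andP[_ xyb].
  have c1 : 1 <= c by rewrite /c le_max lexx.
  have cb : b <= c by rewrite /c le_max lexx orbT.
  move: (c) c1 cb => {}c c1 cb; split; rewrite /= in_itv /=; apply/andP; split;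
    move: xyb; rewrite !expr2; nra.
Qed.

(** Here [x] is the squared modulus of a maximum point and [b] the relative radius of the averaging
    circle. The last two bounds keep the disc inside the annulus; [6 * b <= x] makes the gain
    [b^2 * x] beat the error [11 * k * b^3], as [k < 1 / 2]. *)
Lemma circle_radius (x : R) (S : R) : 0 < x -> x < 1 -> S < x ->
  exists b : R, [/\ 0 < b, b < 1, 6 * b <= x, x * (1 + b) ^+ 2 <= 1 & S <= x * (1 - b) ^+ 2].
Proof.
move=> x0 x1 Sx; pose b := Num.min (x / 6) (Num.min ((1 - x) / 3) ((x - S) / 2)).
have b0 : 0 < b by rewrite /b !lt_min; apply/and3P; split; lra.
have b1 : b <= x / 6 by rewrite /b ge_min lexx.
have b2 : b <= (1 - x) / 3 by rewrite /b !ge_min lexx orbT.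
have b3 : b <= (x - S) / 2 by rewrite /b !ge_min lexx !orbT.
have b4 : b < 1 by lra.
have xb : x * b <= b by rewrite ler_piMl ?ltW.
have bb : x * (b * b) <= x * b by rewrite ler_wpM2l ?(ltW x0)// ler_piMl ?ltW.
have xbb : 0 <= x * (b * b) by rewrite mulr_ge0 ?ltW// mulr_gt0.
move: (b) b0 b1 b2 b3 b4 xb bb xbb => {}b b0 b1 b2 b3 b4 xb bb xbb.
by exists b; rewrite !expr2; split => //; lra.
Qed.

Lemma csqnorm_1Dcircle (b t : R) :
  csqnorm (1 + (b%:C)%C * circle t : Cx R) = 1 + (2 * b * cos t + b ^+ 2).
Proof.
rewrite /csqnorm /=; have := cos2Dsin2 t; move: (cos t) (sin t) => x y xy.
transitivity (1 + 2 * b * x + b ^+ 2 * (x ^+ 2 + y ^+ 2)); first by ring.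
by rewrite xy; ring.
Qed.

Lemma csqnorm_1D_bounds (b : R) (c : Cx R) : 0 < b -> b < 1 -> `|c| <= 1 ->
  (1 - b) ^+ 2 <= csqnorm (1 + (b%:C)%C * c : Cx R) <= (1 + b) ^+ 2.
Proof.
move=> b0 b1; rewrite normCx_le1; case: c => x y; rewrite /csqnorm /=.
move=> xy; have x1 : -1 <= x by nra.
have x2 : x <= 1 by nra.
have -> : (1 + (b * x - 0 * y)) ^+ 2 + (0 + (b * y + 0 * x)) ^+ 2 =
  1 + 2 * b * x + b ^+ 2 * (x ^+ 2 + y ^+ 2) by ring.
have bxy : b ^+ 2 * (x ^+ 2 + y ^+ 2) <= b ^+ 2.
  by rewrite -[leRHS]mulr1 ler_wpM2l ?sqr_ge0.
apply/andP; split; last by nra.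
have y0 : 0 <= b ^+ 2 * y ^+ 2 by rewrite mulr_ge0 ?sqr_ge0.
have bx : 1 - b <= 1 + b * x by nra.
have : (1 - b) ^+ 2 <= (1 + b * x) ^+ 2 by rewrite ler_pXn2r ?nnegrE//; lra.
rewrite !expr2 in y0 *; nra.
Qed.

Lemma cvg_lnD (T : Type) (F : set_system T) {FF : Filter F} (q : T -> R) (k a : R) :
  0 < a -> q @ F --> a -> (fun t => - (k * ln (q t)) + q t) @ F --> - (k * ln a) + a.
Proof.
move=> a0 qa; have cln := cvg_comp _ _ qa (continuous_ln a0).
by apply: cvgD => //; apply: cvgN; apply: cvgMl_tmp; exact: cln.
Qed.

(* Maximum principle for [u - k log |c|^2 + |c|^2] on an annulus. The factor
   [k < 1 / 2] makes it small near [c = 0]. At an interior maximum [al], average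
   over the circle [al (1 + b e^{it})]: the second-order terms of the logarithm
   cancel, leaving an error O(b^3), while [|c|^2] gains [b^2 |al|^2]. *)
Lemma psh_log_bound D u (w v : 'rV[Cx R]_n) (C s0 : R) : psh_on D u ->
  (forall x, D x -> u x <= 0)%E ->
  (forall c : Cx R, `|c| <= 1 -> D (w + c *: v)) -> 0 < s0 ->
  (forall c : Cx R, 0 < csqnorm c < s0 ->
    (u (w + c *: v)%R <= (ln (csqnorm c) / 2 + C)%:E)%E) ->
  forall c : Cx R, 0 < csqnorm c <= 1 ->
    (u (w + c *: v)%R <= (ln (csqnorm c) / 2 + 1)%:E)%E.
Proof.
move=> pu u0 Dwv s00 uC c /andP[c0 c1].
suff key k : 0 < k < 1 / 2 -> (u (w + c *: v)%R <= (k * ln (csqnorm c) + 1)%:E)%E.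
  have L0 : ln (csqnorm c) <= 0 by exact: ln_le0.
  move: (ln _) L0 key => L L0 key.
  have := u0 _ (Dwv c _); rewrite normCx_le1 => /(_ c1).
  case: (u _) key => [U||]//= key _; last by rewrite leNye.
  rewrite lee_fin leNgt; apply/negP => LU.
  have [L0'|L0'] := eqVneq L 0.
    have := key (1 / 4); rewrite L0' mulr0 lee_fin => H.
    have : U <= 0 + 1 by apply: H; lra.
    by move: LU; rewrite L0'; lra.
  have Lneg : L < 0 by rewrite lt_neqAle L0' L0.
  (* Replacing the factor [1 / 2] by [1 / 2 - d] costs [d * (- L)], which this [d] keeps below the
     assumed excess of [U]; the second term of the denominator keeps [d] below [1 / 2]. *)
  pose d := (U - (L / 2 + 1)) / (2 * (- L) + 4 * (U - (L / 2 + 1))).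
  have e0 : 0 < U - (L / 2 + 1) by lra.
  have den : 0 < 2 * (- L) + 4 * (U - (L / 2 + 1)) by lra.
  have d0 : 0 < d by rewrite divr_gt0.
  have d1 : d < 1 / 2 by rewrite ltr_pdivrMr//; lra.
  have := key (1 / 2 - d); rewrite lee_fin =>  H.
  have {H} : U <= (1 / 2 - d) * L + 1 by apply: H; lra.
  have : d * (- L) < U - (L / 2 + 1).
    by rewrite /d mulrAC ltr_pdivrMr//; nra.
  lra.
move=> /andP[k0 k2]; rewrite leNgt; apply/negP => ck.
(* The squared inner radius [S] lies below [s0], so that [uC] applies on the inner circle, and below
   [csqnorm c], so that [c] is in the annulus. The third entry gives [(1 / 2 - k) * ln S + C <= 0],
   whence [f <= S <= 1] on the inner circle. *)
pose S := Num.min (Num.min (s0 / 2) (csqnorm c / 2)) (expR (- (C / (1 / 2 - k)))).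
have S0 : 0 < S by rewrite /S !lt_min expR_gt0 andbT; apply/andP; split; lra.
have Ss : S < s0 by apply: (@le_lt_trans _ _ (s0 / 2)); [rewrite /S !ge_min lexx|lra].
have Sc : S < csqnorm c.
  by apply: (@le_lt_trans _ _ (csqnorm c / 2)); [rewrite /S !ge_min lexx orbT|lra].
have S1 : S <= 1 by lra.
have lnS : (1 / 2 - k) * ln S + C <= 0.
  have : ln S <= - (C / (1 / 2 - k)).
    by rewrite -[leRHS]expRK ler_ln ?posrE ?expR_gt0// /S ge_min lexx orbT.
  have k3 : 0 < 1 / 2 - k by lra.
  move=> /(ler_wpM2l (ltW k3)); rewrite mulrN mulrCA divff ?gt_eqF// mulr1; lra.
pose sq (p : R * R) : R := p.1 ^+ 2 + p.2 ^+ 2.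
pose f (p : R * R) := (u (w + (Complex p.1 p.2 : Cx R) *: v)%R +
  (- (k * ln (sq p)) + sq p)%:E)%E.
pose K := [set p : R * R | S <= sq p <= 1].
have DK p : K p -> D (w + (Complex p.1 p.2 : Cx R) *: v).
  by move=> /andP[_ p1]; apply: Dwv; rewrite normCx_le1.
have Kc : K (complex.Re c, complex.Im c) by rewrite /K /= c1 andbT ltW.
have cE : (Complex (complex.Re c) (complex.Im c) : Cx R) = c by case: (c).
have [|p Kp||p a Kp fpa|[x y] Kp pmax] := @usc_compact_max _ _ K f (- (k * ln S) + 1).
- exact: compact_annulus.
- have pu0 := u0 _ (DK p Kp); move: Kp => /andP[Sp p1].
  rewrite /f -[leRHS]add0e; apply: leeD => //; rewrite lee_fin lerD// lerN2.
  by rewrite ler_wpM2l ?(ltW k0)// ler_ln// posrE (lt_le_trans S0).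
- exists (complex.Re c, complex.Im c) => //=; rewrite /f /= cE.
  move: ck; case: (u _) => [r||]// _; rewrite ltNyr//.
- have [_ uusc _] := pu; have qp : 0 < sq p by move: Kp => /andP[/(lt_le_trans S0)].
  move: fpa; rewrite /f; set r := - (k * ln (sq p)) + sq p.
  rewrite -lteBrDr// -EFinB => /lte_fin_between[a' a'a ua'].
  have cline : (fun p : R * R => w + (Complex p.1 p.2 : Cx R) *: v) @ p -->
      w + (Complex p.1 p.2 : Cx R) *: v.
    apply: (@cvg_line _ _ _ (nbhs p) (nbhs_filter p)); last exact: cvg_cst.
    apply: (@cvg_Complex _ _ (nbhs p) (nbhs_filter p)).
      exact: cvg_fst.
    exact: cvg_snd.
  have csq : sq @ p --> sq p.
    apply: (@cvg_sqrD _ _ (nbhs p) (nbhs_filter p)).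
      exact: cvg_fst.
    exact: cvg_snd.
  have cr : (fun p => - (k * ln (sq p)) + sq p) @ p --> r.
    exact: (@cvg_lnD _ (nbhs p) (nbhs_filter p)).
  have u_near := cline _ (uusc _ _ (DK _ Kp) ua').
  have ra : r < a - a' by lra.
  have r_near := @cvgr_lt _ _ _ (nbhs_filter p) _ _ cr _ ra.
  near=> p' => _.
  have H1 : (u (w + (Complex p'.1 p'.2 : Cx R) *: v)%R < a'%:E)%E by near: p'.
  have H2 : - (k * ln (sq p')) + sq p' < a - a' by near: p'.
  rewrite (_ : a%:E = a'%:E + (a - a')%:E)%E; last by rewrite -EFinD addrC subrK.
  by rewrite lteD// lte_fin.
(* On both boundary circles [f <= 1], so a maximum above [1] is interior. *)
have f1 : (1%:E < f (x, y))%E.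
  apply: lt_le_trans (pmax _ Kc); rewrite /f /= cE.
  move: ck; case: (u _) => [r||]//; last by move=> _; rewrite addye// ltry.
  rewrite lte_fin -EFinD lte_fin /sq/= -/(csqnorm c); lra.
pose al : Cx R := Complex x y.
have [U uU] : exists U, u (w + al *: v) = U%:E.
  move: f1; rewrite /f /= -/al; have := u0 _ (DK _ Kp); rewrite /= -/al.
  by case: (u _) => [r||]//; exists r.
set r := sq (x, y); have csqal : csqnorm al = r by [].
have /andP[Sr r1] : S <= r <= 1 by exact: Kp.
have r0 : 0 < r by lra.
have fE : f (x, y) = (U - k * ln r + r)%:E by rewrite /f /= -/al uU -EFinD addrA.
have U0 : U <= 0 by rewrite -lee_fin -uU; exact: (u0 _ (DK _ Kp)).
have rlt1 : r < 1.
  rewrite lt_neqAle r1 andbT; apply/eqP => r1'.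
  move: f1; rewrite fE lte_fin r1' ln1; lra.
have Slt : S < r.
  rewrite lt_neqAle Sr andbT; apply/eqP => Sr'.
  have := uC al; rewrite csqal r0 -{1}Sr' Ss => /(_ isT); rewrite uU lee_fin -Sr' => US.
  move: f1; rewrite fE lte_fin -Sr'; lra.
have [b [b0 b1 br brU brL]] := circle_radius r0 rlt1 Slt.
have lineE (e : Cx R) : (w + al *: v) + e *: (((b%:C)%C * al) *: v) =
    w + (al * (1 + (b%:C)%C * e)) *: v.
  by rewrite scalerA -addrA -scalerDl; congr (_ + _ *: _); ring.
have annulus (e : Cx R) : `|e| <= 1 -> S <= csqnorm (al * (1 + (b%:C)%C * e)) <= 1.
  move=> e1; rewrite csqnormM csqal; have /andP[H1 H2] := csqnorm_1D_bounds b0 b1 e1.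
  rewrite (le_trans brL) ?ler_pM2l//=.
  by rewrite (le_trans _ brU)// ler_pM2l.
(* With [p = 2 * b * cos t + b^2], comparing [f] on the circle with its maximum gives
   [u <= U + k * ln (1 + p) - r * p]; the logarithm is then expanded. *)
have uP t : (u ((w + al *: v) + circle t *: (((b%:C)%C * al) *: v))%R <=
    ((U + k * (b ^+ 2 + 11 * b ^+ 3) - r * b ^+ 2) + (2 * b * k - 2 * b * r) * cos t +
      (- (2 * b ^+ 2 * k)) * cos t ^+ 2)%:E)%E.
  rewrite lineE; set d : Cx R := al * _.
  have dE : (Complex (complex.Re d) (complex.Im d) : Cx R) = d by case: (d).
  have Kd : K (complex.Re d, complex.Im d) by exact: annulus (circle_le1 t).
  have := pmax _ Kd; rewrite fE /f.
  rewrite /sq /fst /snd dE.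
  rewrite -/(csqnorm d) csqnormM csqal csqnorm_1Dcircle -leeBrDr// -EFinB => /le_trans; apply.
  have [c1' c2'] := (cos_geN1 t, cos_le1 t).
  move: (cos t) c1' c2' => x' x1 x2; set p := 2 * b * x' + b ^+ 2.
  have p1 : -1 < p by rewrite /p expr2; nra.
  rewrite lee_fin lnM ?posrE//; last by lra.
  have bb : b * b <= b by rewrite ler_piMl ?ltW.
  have p3 : p <= 3 * b by rewrite /p expr2; nra.
  have pc : p ^+ 3 <= (3 * b) ^+ 3.
    have [p0|p0] := leP 0 p; first by rewrite ler_pXn2r// nnegrE; lra.
    by rewrite (@le_trans _ _ 0)//; [rewrite exprn_odd_le0// ltW|rewrite exprn_ge0//; lra].
  have lnp := ln1D_le_taylor3 p1.
  have b30 : 0 <= b ^+ 3 by rewrite exprn_ge0// ltW.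
  have b40 : 0 <= b ^+ 4 by rewrite exprn_ge0// ltW.
  have bx : - (2 * b ^+ 3 * x') <= 2 * b ^+ 3 by nra.
  (* The constant [11] is [2 + 9]: the cross term of [p^2 / 2] contributes [2 * b^3], and [p^3 / 3]
     contributes [9 * b^3] because [p <= 3 * b]. *)
  have {}lnp : ln (1 + p) <= 2 * b * x' + b ^+ 2 - 2 * b ^+ 2 * x' ^+ 2 + 11 * b ^+ 3.
    apply: (le_trans lnp).
    have -> : p - p ^+ 2 / 2 = 2 * b * x' + b ^+ 2 - 2 * b ^+ 2 * x' ^+ 2 - 2 * b ^+ 3 * x' - b ^+ 4 / 2.
      by rewrite /p; field.
    move: pc; have -> : (3 * b) ^+ 3 = 27 * b ^+ 3 by ring.
    lra.
  have := ler_wpM2l (ltW k0) lnp; rewrite /p; lra.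
have := psh_le_circle_poly pu u0 _ _ uP; rewrite uU ltNyr => H.
have : ((2 * pi)%:E * U%:E <= (2 * pi * (U + k * (b ^+ 2 + 11 * b ^+ 3) - r * b ^+ 2) +
    pi * (- (2 * b ^+ 2 * k)))%:E)%E.
  apply: H => // e e1; rewrite lineE; apply: Dwv; rewrite normCx_le1.
  by have /andP[] := annulus e e1.
rewrite -EFinM lee_fin => {}H.
(* After averaging, [U] and the terms [k * b^2] cancel, leaving [r <= 11 * k * b]; but
   [11 * k * b < 6 * b <= r]. *)
have : 0 <= pi * (b ^+ 2 * (11 * k * b - r)) *+ 2 by lra.
rewrite pmulrn_lge0// pmulr_rge0 ?pi_gt0// pmulr_rge0 ?exprn_gt0//; nra.
Unshelve. all: by end_near.
Qed.


End psh_on_lines.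

(** * Plurisubharmonicity of the Green function *)

Section limn_einf_bounds.
Context {R : realType}.
Implicit Types (f : (\bar R)^nat) (b : \bar R).

Lemma limn_einfE f : limn_einf f = ereal_sup (range (einfs f)).
Proof. by rewrite limn_einf_lim; apply/cvg_lim => //; exact: cvg_einfs_sup. Qed.

Lemma limn_einf_le f b : (forall k, f k <= b)%E -> (limn_einf f <= b)%E.
Proof.
move=> fb; rewrite limn_einfE; apply: ge_ereal_sup => _ [k _ <-].
by apply: (le_trans _ (fb k)); apply: ereal_inf_lbound; exists k => /=.
Qed.

Lemma le_limn_einf f b : (\forall k \near \oo, b <= f k)%E -> (b <= limn_einf f)%E.
Proof.
move=> [N _ Nf]; rewrite limn_einfE; apply: (@le_trans _ _ (einfs f N)).
  by apply: le_ereal_inf_tmp => _ [k /= Nk <-]; exact: Nf.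
by apply: ereal_sup_ubound; exists N.
Qed.

Lemma lee_from_reals (x y : \bar R) : (forall a : R, x < a%:E -> y <= a%:E)%E -> (y <= x)%E.
Proof.
move: x y => [x||] y H; last 2 first.
- by rewrite leey.
- case: y H => [y||]// H.
    by have := H (y - 1 : R) (ltNyr (y - 1 : R)); rewrite lee_fin => Hy; exfalso; lra.
  by have := H 0%R (ltNyr (0 : R)).
- apply/lee_addgt0Pr => e e0; rewrite -EFinD; apply: H.
  by rewrite lte_fin ltrDl.
Qed.

Lemma lee_from_reals_lt (x y : \bar R) : (forall a : R, a%:E < x -> a%:E <= y)%E -> (x <= y)%E.
Proof.
move=> H; rewrite -leeN2; apply: lee_from_reals => a.
by rewrite lteNl leeNl -EFinN => /H.
Qed.

End limn_einf_bounds.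

Section usc_regularization.
Context {R : realType} {T : topologicalType}.
Implicit Types (f : T -> \bar R) (z : T).

(** The neighbourhoods are not punctured: the value at [z] counts, so the result majorizes [f]. *)
Definition usc_reg f z := ereal_inf [set ereal_sup (f @` A) | A in nbhs z].

Lemma le_usc_reg f z : (f z <= usc_reg f z)%E.
Proof.
apply: le_ereal_inf_tmp => _ [A zA <-]; apply: ereal_sup_ubound.
by exists z => //; exact: nbhs_singleton.
Qed.

Lemma usc_reg_le f z (a : \bar R) : (\forall y \near z, f y <= a)%E -> (usc_reg f z <= a)%E.
Proof.
move=> fa; apply: (@le_trans _ _ (ereal_sup (f @` [set y | (f y <= a)%E]))).
  by apply: ereal_inf_lbound; exists [set y | (f y <= a)%E].
by apply: ge_ereal_sup => _ [y ya <-].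
Qed.

Lemma usc_reg_lt f z (a : \bar R) : (usc_reg f z < a)%E ->
  \forall y \near z, (usc_reg f y < a)%E.
Proof.
move=> /ereal_inf_lt[_ [A zA <-] Aa].
have : nbhs z A^° by exact: nbhs_interior.
apply: filterS => y yA; apply: le_lt_trans Aa; apply: ereal_inf_lbound.
by exists A.
Qed.

Lemma usc_reg_gt f z (a : \bar R) (A : set T) : (a < usc_reg f z)%E -> nbhs z A ->
  exists2 y, A y & (a < f y)%E.
Proof.
move=> az zA; have : (a < ereal_sup (f @` A))%E.
  by apply: (lt_le_trans az); apply: ereal_inf_lbound; exists A.
by move=> /ereal_sup_gt[_ [y Ay <-]] ay; exists y.
Qed.

End usc_regularization.

Section sub_mean_limit.
Context {R : realType} (n : nat).

Lemma compact_disc : compact [set c : Cx R | `|c| <= 1].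
Proof.
rewrite (_ : mkset _ = (fun p : R * R => Complex p.1 p.2 : Cx R) @`
    [set p : R * R | 0 <= p.1 ^+ 2 + p.2 ^+ 2 <= 1]); last first.
  apply/seteqP; split => [[x y]|_ [[x y] /= H <-]] /=.
    rewrite normCx_le1 => xy; exists (x, y) => //=.
    by rewrite xy addr_ge0 ?sqr_ge0.
  by rewrite normCx_le1; case/andP: H.
apply: continuous_compact; last exact: compact_annulus.
apply: continuous_subspaceT => p.
apply: (@cvg_Complex _ _ (nbhs p) (nbhs_filter p)).
  exact: cvg_fst.
exact: cvg_snd.
Qed.

(** Compactness of the closed disc lets a single neighbourhood of [z] serve all [c]. *)
Lemma near_disc (D : set 'rV[Cx R]_n) (z v : 'rV[Cx R]_n) : open D ->
  (forall c : Cx R, `|c| <= 1 -> D (z + c *: v)) ->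
  \forall y \near z, forall c : Cx R, `|c| <= 1 -> D (y + c *: v).
Proof.
move=> oD Dzv; have /compact_near_coveringP cov := compact_disc.
apply: (cov _ (nbhs z) (fun y c => D (y + c *: v))) => c c1.
have cl : (fun p : Cx R * 'rV[Cx R]_n => p.2 + p.1 *: v) @ (c, z) --> z + c *: v.
  apply: (@cvg_line _ _ _ (nbhs (c, z)) (nbhs_filter (c, z))).
    exact: cvg_fst.
  exact: cvg_snd.
have : nbhs (z + c *: v) D by apply: open_nbhs_nbhs; split => //; exact: Dzv.
by move=> /cl; apply: filterS => -[].
Qed.

(* Fatou's lemma carries the sub-mean value inequality from points [y] near
   [z] with [a < u y] over to [z]. *)
Lemma sub_mean_of_near (D : set 'rV[Cx R]_n) (u : 'rV[Cx R]_n -> \bar R)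
    (z v : 'rV[Cx R]_n) (a : R) : open D ->
  (forall x, u x <= 0)%E ->
  (forall x (b : R), D x -> (u x < b%:E)%E -> \forall y \near x, (u y < b%:E)%E) ->
  (forall c : Cx R, `|c| <= 1 -> D (z + c *: v)) ->
  (forall A, nbhs z A -> exists2 y, A y & (forall c : Cx R, `|c| <= 1 -> D (y + c *: v)) ->
    ((2 * pi * a)%:E <=
      \int[lebesgue_measure]_(t in `[0%R, (2 * pi)%R]) u (y + circle t *: v)%R)%E) ->
  ((2 * pi * a)%:E <=
    \int[lebesgue_measure]_(t in `[0%R, (2 * pi)%R]) u (z + circle t *: v)%R)%E.
Proof.
move=> oD u0 uusc Dzv near_z.
(* Fatou's lemma concerns sequences, hence the choice of points [y k] within [1 / (k + 1)] of
   [z]. *)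
have /choice[y yP] (k : nat) : exists y : 'rV[Cx R]_n,
    [/\ ball z ((k.+1%:R^-1)%:C)%C y, forall c : Cx R, `|c| <= 1 -> D (y + c *: v)
    & ((2 * pi * a)%:E <= \int[lebesgue_measure]_(t in `[0%R, (2 * pi)%R])
       u (y + circle t *: v)%R)%E].
  have k0 : 0 < ((k.+1%:R^-1)%:C)%C :> Cx R.
    by rewrite (_ : 0 = (0%:C)%C :> Cx R)// ltcR invr_gt0.
  have [y [By Dy] ay] := near_z _ (filterI (nbhsx_ballx z _ k0) (near_disc oD Dzv)).
  by exists y; split => //; exact: ay Dy.
have yz : y @ \oo --> z.
  apply/cvg_ballP => e /Cx_posP[r r0 ->].
  near=> k; have [Bk _ _] := yP k; apply: (le_ball _ Bk).
  rewrite lecR; apply: ltW.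
  by near: k; exact: (@near_infty_natSinv_lt R (PosNum r0)).
have mu (x : 'rV[Cx R]_n) : (forall c : Cx R, `|c| <= 1 -> D (x + c *: v)) ->
    measurable_fun setT (fun t : R => - u (x + circle t *: v)%R)%E.
  move=> Dxv; apply: measurableT_comp => //.
  apply: (usc_on_measurable_comp uusc); first exact: continuous_circle_line.
  by move=> t; apply: Dxv; exact: circle_le1.
have intN (x : 'rV[Cx R]_n) : (\int[lebesgue_measure]_(t in `[0%R, (2 * pi)%R])
      u (x + circle t *: v)%R = - \int[lebesgue_measure]_(t in `[0%R, (2 * pi)%R])
      - u (x + circle t *: v)%R)%E.
  rewrite -integral_ge0N; last by move=> t _; rewrite oppe_ge0.
  by under [RHS]eq_integral do rewrite oppeK.
rewrite intN leeNr.
pose f (k : nat) (t : R) := (- u (y k + circle t *: v)%R)%E.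
apply: (@le_trans _ _ (\int[lebesgue_measure]_(t in `[0%R, (2 * pi)%R])
    limn_einf (fun k => f k t))%E).
  apply: ge0_le_integral => //.
  - by move=> t _; rewrite oppe_ge0.
  - by apply: measurable_funTS; exact: mu.
  - apply: measurableT_comp => //; apply: measurable_fun_limn_esup => k.
    apply: measurableT_comp => //; apply: measurable_funTS; apply: mu.
    by have [] := yP k.
  (* Upper semicontinuity at the limit point: there [- u] is at most the lower limit of [f k t]. *)
  - move=> t _; apply: lee_from_reals_lt => b bu; apply: le_limn_einf.
    have Dt : D (z + circle t *: v) by apply: Dzv; exact: circle_le1.
    have ub : (u (z + circle t *: v)%R < (- b)%:E)%E by rewrite EFinN lteNr.
    have yt : (fun k => y k + circle t *: v) @ \oo --> z + circle t *: v.
      by apply: (@cvg_line _ _ _ _ _ (fun=> circle t) y (circle t)) => //; exact: cvg_cst.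
    have H : \forall k \near \oo, (u (y k + circle t *: v)%R < (- b)%:E)%E.
      exact: yt (uusc _ _ Dt ub).
    near=> k; rewrite /f leeNr -EFinN ltW//; near: k; exact: H.
apply: (@le_trans _ _ (limn_einf (fun k => \int[lebesgue_measure]_(t in `[0%R, (2 * pi)%R])
    f k t))%E).
  apply: fatou => //.
  - by move=> k; apply: measurable_funTS; apply: mu; have [] := yP k.
  - by move=> k t _; rewrite /f oppe_ge0.
by apply: limn_einf_le => k; rewrite -leeNr -intN; have [] := yP k.
Unshelve. all: by end_near. Qed.
End sub_mean_limit.

Section enorm_facts.
Context {R : realType} (n : nat).
Implicit Types (v : 'rV[Cx R]_n).

Lemma enorm_ge0 v : 0 <= enorm v.
Proof. exact: sqrtr_ge0. Qed.

Lemma enormZ (c : Cx R) v : enorm (c *: v) = Num.sqrt (csqnorm c) * enorm v.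
Proof.
rewrite /enorm -sqrtrM ?csqnorm_ge0// mulr_sumr; congr Num.sqrt.
by apply: eq_bigr => i _; rewrite mxE csqnormM.
Qed.

Lemma enorm0 : enorm (0 : 'rV[Cx R]_n) = 0.
Proof.
rewrite /enorm big1 ?sqrtr0// => i _; rewrite mxE /csqnorm /=.
by rewrite expr0n addr0.
Qed.

Lemma csqnorm_le_enorm v i : csqnorm (v 0 i) <= enorm v ^+ 2.
Proof.
rewrite sqr_sqrtr; last by apply: sumr_ge0 => j _; exact: csqnorm_ge0.
by rewrite (bigD1 i)//= lerDl; apply: sumr_ge0 => j _; exact: csqnorm_ge0.
Qed.

Lemma enorm_gt0 v : v != 0 -> 0 < enorm v.
Proof.
move=> v0; rewrite lt_neqAle enorm_ge0 andbT eq_sym; apply: contra_neq v0 => v0.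
apply/rowP => i; rewrite mxE; apply: csqnorm_eq0; apply/eqP.
by rewrite eq_le csqnorm_ge0 andbT (le_trans (csqnorm_le_enorm v i))// v0 expr0n.
Qed.

Lemma open_enorm (A : set 'rV[Cx R]_n) (a : 'rV[Cx R]_n) : nbhs a A ->
  exists2 r : R, 0 < r & forall v, enorm v <= r -> A (a + v).
Proof.
move=> /nbhs_ballP[e /Cx_posP[r r0 ->] eA]; exists (r / 2); first by rewrite divr_gt0.
move=> v vr; apply: eA; split=> [|j i].
  by rewrite (_ : 0 = (0%:C)%C :> Cx R)// ltcR.
rewrite ord1 /ball/= mxE opprD addrA subrr add0r normrN normCxE ltcR.
rewrite -[ltRHS]ger0_norm ?(ltW r0)// -sqrtr_sqr ltr_sqrt ?exprn_gt0//.
apply: (le_lt_trans (csqnorm_le_enorm v i)).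
by rewrite ltr_pXn2r ?nnegrE ?enorm_ge0 ?ltW//; apply: (le_lt_trans vr); lra.
Qed.

Lemma cvg_enorm (T : Type) (F : set_system T) {FF : Filter F} (f : T -> 'rV[Cx R]_n) v :
  f @ F --> v -> (fun t => enorm (f t)) @ F --> enorm v.
Proof.
move=> fv; rewrite /enorm.
have fi i : (fun t => csqnorm (f t 0 i)) @ F --> csqnorm (v 0 i).
  have fvi : (fun t => f t 0 i) @ F --> v 0 i.
    exact: (cvg_comp _ _ fv (@coord_continuous _ _ _ 0 i v)).
  exact: (cvg_comp _ _ fvi (@csqnorm_continuous R (v 0 i))).
have fs : (fun t => \sum_(i < n) csqnorm (f t 0 i)) @ F --> \sum_(i < n) csqnorm (v 0 i).
  by apply: cvg_big => [|i _]; [exact: add_continuous|exact: fi].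
exact: (cvg_comp _ _ fs (@sqrt_continuous R _)).
Qed.

End enorm_facts.

Section log_dist_facts.
Context {R : realType} (n : nat) (M : complexManifold R n).
Implicit Types (c : chart R n M) (z w : M) (u : M -> \bar R).

Lemma lne_lt_EFin (x a : R) : 0 <= x -> (lne x%:E < a%:E)%E = (x < expR a).
Proof.
rewrite le_eqVlt => /predU1P[<-|x0].
  by rewrite le0_lneNy// ltNyr expR_gt0.
by rewrite lne_EFin// lte_fin -{1}(expRK a) ltr_ln// posrE expR_gt0.
Qed.

Lemma log_distxx c w : log_dist c w w = -oo%E.
Proof. by rewrite /log_dist subrr enorm0 le0_lneNy. Qed.

Lemma chart_inj c x y : cdom c x -> cdom c y -> cmap c x = cmap c y -> x = y.
Proof.
move=> cx cy xy; have cK := @cmapK _ _ _ c.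
by rewrite -(cK x) ?inE// xy cK// inE.
Qed.

Lemma cinvK c (z : 'rV[Cx R]_n) : cimg c z -> cdom c (cinv c z) /\ cmap c (cinv c z) = z.
Proof. by move=> [x cx <-]; rewrite (@cmapK _ _ _ c)// inE. Qed.

Lemma nbhs_cdom c z : cdom c z -> nbhs z (cdom c).
Proof. by move=> cz; apply: open_nbhs_nbhs; split => //; exact: cdom_open. Qed.

Lemma nbhs_cimg c (x : 'rV[Cx R]_n) : cimg c x -> nbhs x (cimg c).
Proof. by move=> cz; apply: open_nbhs_nbhs; split => //; exact: cimg_open. Qed.

Lemma cvg_cmap c z : cdom c z -> cmap c @ z --> cmap c z.
Proof. by move=> cz; apply: (@cmap_continuous _ _ _ c); rewrite inE. Qed.

Lemma cvg_cinv c (x : 'rV[Cx R]_n) : cimg c x -> cinv c @ x --> cinv c x.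
Proof. by move=> cz; apply: (@cinv_continuous _ _ _ c); rewrite inE. Qed.

Lemma cvg_log_enorm c z w : cdom c z ->
  (fun y => enorm (cmap c y - cmap c w)) @ z --> enorm (cmap c z - cmap c w).
Proof.
move=> cz; apply: cvg_enorm; apply: cvgB; last exact: cvg_cst.
exact: cvg_cmap.
Qed.

Lemma log_dist_lt_near c z w (a : R) : cdom c z -> (log_dist c z w < a%:E)%E ->
  \forall y \near z, (log_dist c y w < a%:E)%E.
Proof.
move=> cz; rewrite lne_lt_EFin ?enorm_ge0// => za.
have H := cvgr_lt _ (@cvg_log_enorm c z w cz) _ za.
near=> y; rewrite /log_dist lne_lt_EFin ?enorm_ge0//; near: y; exact: H.
Unshelve. all: by end_near. Qed.

(* Members of the family defining the Green function obey one logarithmic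
   bound near the pole, with a constant that does not depend on the member. *)
Lemma log_pole_uniform c w : atlas c -> cdom c w ->
  exists C : R, \forall z \near w, forall u, negative_psh u -> log_pole u w ->
    (u z <= log_dist c z w + C%:E)%E.
Proof.
move=> ac cw; set a := cmap c w.
have ca : cimg c a by exists w.
have wE : cinv c a = w by rewrite /a (@cmapK _ _ _ c)// inE.
have [r r0 rc] := open_enorm (nbhs_cimg ca).
(* The vector [v] below is the direction of [z] scaled to norm [r]; along it [log_dist] is
   [ln (csqnorm x) / 2 + ln r], and the maximum principle has the constant [1]. Neither depends on
   [u]. *)
exists (1 - ln r); have c_near := nbhs_cdom cw.
have r_near : \forall z \near w, enorm (cmap c z - a) < r.
  by apply: (cvgr_lt _ (@cvg_log_enorm c w w cw)); rewrite subrr enorm0.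
near=> z => u [pu u0] /(_ c ac cw)[C' uC'].
have [->|zw] := eqVneq z w.
  by have := nbhs_singleton uC'; rewrite log_distxx.
have cz : cdom c z by near: z.
have zr : enorm (cmap c z - a) < r by near: z.
set v0 := cmap c z - a in zr.
have v00 : v0 != 0.
  by apply: contra_neq zw => /eqP; rewrite subr_eq0 => /eqP; exact: chart_inj.
have e0 := enorm_gt0 v00; set rho := enorm v0 in zr e0.
pose v := ((r / rho)%:C)%C *: v0; pose zeta : Cx R := ((rho / r)%:C)%C.
have csR (x : R) : csqnorm ((x%:C)%C : Cx R) = x ^+ 2 by rewrite /csqnorm /= expr0n addr0.
have vr : enorm v = r.
  by rewrite enormZ csR sqrtr_sqr ger0_norm ?divr_ge0 ?ltW// -/rho mulfVK// gt_eqF.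
have zE : a + zeta *: v = cmap c z.
  have zr1 : zeta * ((r / rho)%:C)%C = 1.
    rewrite /zeta -(rmorphM (real_complex R)) (_ : rho / r * (r / rho) = 1)//.
    by field; rewrite !gt_eqF.
  rewrite scalerA zr1 scale1r.
  by rewrite /v0 addrC subrK.
have Dav (x : Cx R) : `|x| <= 1 -> cimg c (a + x *: v).
  rewrite normCx_le1 => x1; apply: rc; rewrite enormZ vr -[leRHS]mul1r ler_wpM2r ?(ltW r0)//.
  by rewrite -[leRHS]sqrtr1 ler_wsqrtr.
have cs (x : Cx R) : 0 < csqnorm x -> csqnorm x <= 1 ->
    log_dist c (cinv c (a + x *: v)) w = (ln (csqnorm x) / 2 + ln r)%:E.
  move=> x0 x1; have /cinvK[_ cE] : cimg c (a + x *: v) by apply: Dav; rewrite normCx_le1.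
  rewrite /log_dist cE -/a [a + _]addrC addrK enormZ vr.
  have q0 : 0 < Num.sqrt (csqnorm x) by rewrite sqrtr_gt0.
  rewrite lne_EFin ?mulr_gt0// lnM ?posrE//; congr (_ + _)%:E.
  have -> : ln (csqnorm x) = ln (Num.sqrt (csqnorm x)) *+ 2.
    by rewrite -lnXn// sqr_sqrtr// ltW.
  by rewrite mulr2n; field.
have csz : csqnorm zeta = (rho / r) ^+ 2 := csR _.
have rr1 : rho / r < 1 by rewrite ltr_pdivrMr// mul1r.
have rr0 : 0 < rho / r by rewrite divr_gt0.
(* The radius given by [s0], like [C'], varies with [u]. The maximum principle needs some such
   radius, but neither enters its conclusion. *)
have [s0 [s00 s01 Hs0]] : exists s0 : R, [/\ 0 < s0, s0 <= 1 & forall x : Cx R, csqnorm x < s0 ->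
    (u (cinv c (a + x *: v)) <= log_dist c (cinv c (a + x *: v)) w + C'%:E)%E].
  have line0 : (fun x : Cx R => a + x *: v) @ (0 : Cx R) --> a.
    rewrite -[X in _ --> X]addr0 -(scale0r v).
    apply: (@cvg_line _ _ _ (nbhs (0 : Cx R)) (nbhs_filter (0 : Cx R)) id (fun=> a)).
      exact: cvg_id.
    exact: cvg_cst.
  rewrite -wE in uC'.
  have := line0 _ (cvg_cinv ca uC') => /nbhs_ballP[e /Cx_posP[e' e'0 ->] eP].
  exists (Num.min (e' ^+ 2) 1); split=> [||x xe].
  - by rewrite lt_min exprn_gt0//=.
  - by rewrite ge_min lexx orbT.
  - have := eP x; rewrite /= -wE; apply.
    rewrite /ball/= sub0r normrN normCxE ltcR -[ltRHS]ger0_norm ?(ltW e'0)//.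
    by rewrite -sqrtr_sqr ltr_sqrt ?exprn_gt0//; move: xe; rewrite lt_min => /andP[].
have := @psh_log_bound R n (cimg c) (u \o cinv c) a v (C' + ln r) s0 (pu c ac) _ Dav s00 _ zeta.
rewrite /= zE (@cmapK _ _ _ c) ?inE// csz => H.
have {H} : (u z <= (ln ((rho / r) ^+ 2) / 2 + 1)%:E)%E.
  apply: H => [x _|x /andP[x0 xs]|].
  - exact: u0.
  - apply: (le_trans (Hs0 _ xs)); rewrite cs//; last by rewrite (le_trans (ltW xs)).
    by rewrite -EFinD lee_fin addrA addrAC.
  - by rewrite exprn_gt0// expr_le1// ?ltW.
move=> /le_trans; apply; rewrite /log_dist -/v0 -/rho lne_EFin// -EFinD lee_fin.
by rewrite lnXn// ln_div ?posrE// mulr2n; lra.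
Unshelve. all: by end_near. Qed.

End log_dist_facts.

(** Nonpositive functions may have integral [-oo]; passing to the opposites reduces to the
    nonnegative case, which asks for no integrability. *)
Lemma le0_le_integral d (T : measurableType d) (R : realType)
    (mu : {measure set T -> \bar R}) (D : set T) (f g : T -> \bar R) : measurable D ->
  measurable_fun D f -> measurable_fun D g -> (forall x, g x <= 0)%E ->
  (forall x, f x <= g x)%E -> (\int[mu]_(x in D) f x <= \int[mu]_(x in D) g x)%E.
Proof.
move=> mD mf mg g0 fg.
have f0 x : (f x <= 0)%E by exact: le_trans (g0 x).
have intN (h : T -> \bar R) : (forall x, h x <= 0)%E ->
    (\int[mu]_(x in D) h x = - \int[mu]_(x in D) (- h x))%E.
  move=> h0; rewrite -integral_ge0N; last by move=> x _; rewrite oppe_ge0.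
  by apply: eq_integral => x _; rewrite oppeK.
rewrite (intN f)// (intN g)// leeN2; apply: ge0_le_integral => //.
- by move=> x _; rewrite oppe_ge0.
- exact: measurableT_comp.
- exact: measurableT_comp.
- by move=> x _; rewrite leeN2.
Qed.

Section green_function.
Context {R : realType} (n : nat) (M : complexManifold R n).
Implicit Types (c : chart R n M) (z w : M) (u : M -> \bar R).

Lemma psh_usc u z (a : R) : psh u -> (u z < a%:E)%E -> \forall y \near z, (u y < a%:E)%E.
Proof.
move=> pu ua; have [c ac cz] := atlas_cover z.
have [_ uusc _] := pu c ac.
have zE : cinv c (cmap c z) = z by rewrite (@cmapK _ _ _ c)// inE.
have ic : cimg c (cmap c z) by exists z.
have H : \forall x \near cmap c z, (u (cinv c x) < a%:E)%E.
  by apply: (uusc _ _ ic); rewrite /= zE.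
have {}H := cvg_cmap cz H; have c_near := nbhs_cdom cz.
near=> y; have cy : cdom c y by near: y.
have : (u (cinv c (cmap c y)) < a%:E)%E by near: y; exact: H.
by rewrite (@cmapK _ _ _ c)// inE.
Unshelve. all: by end_near. Qed.

Lemma usc_measurable u : (forall z (a : R), (u z < a%:E)%E -> \forall y \near z, (u y < a%:E)%E) ->
  measurable_fun [set: borel M] u.
Proof.
move=> uusc; have H := measurability (f := (u : borel M -> \bar R)) _ (ErealGenInftyO.measurableE R).
apply: H => // _ [_ [a ->]] <-; rewrite setTI.
apply: sub_sigma_algebra => /=; rewrite openE => z /=; rewrite in_itv/= => za.
have := uusc _ _ za; rewrite /interior; apply: filterS => y; by rewrite /= in_itv.
Qed.

Lemma green_le0 z w : (green z w <= 0)%E.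
Proof. by apply: ge_ereal_sup => _ [u [[_ u0] _] <-]; exact: u0. Qed.

Lemma le_green u z w : negative_psh u -> log_pole u w -> (u z <= green z w)%E.
Proof. by move=> nu lu; apply: ereal_sup_ubound; exists u. Qed.

Let G w := usc_reg (fun z => green z w).

Let G_le0 w z : (G w z <= 0)%E.
Proof. by apply: usc_reg_le; apply: nearW => y; exact: green_le0. Qed.

(** If [a < G w] at a point, then arbitrarily close to it some [y] has [a < green y w], hence a
    competitor [u] with [a < u y]. Its sub-mean value inequality at [y], with [u <= G w] under the
    integral, is what the limit argument carries to the point itself. Only [u] and [G w], known to
    be semicontinuous, are integrated. *)
Let G_psh w : psh (G w).
Proof.
move=> c ac; have G_usc (x : 'rV[Cx R]_n) (a : R) : cimg c x -> ((G w \o cinv c) x < a%:E)%E ->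
    \forall y \near x, ((G w \o cinv c) y < a%:E)%E.
  by move=> cz za; exact: (cvg_cinv cz (usc_reg_lt za)).
split=> // [z _|z v Dzv]; first by rewrite (le_lt_trans (G_le0 _ _)) ?ltry.
have Dz : cimg c z by have := Dzv 0; rewrite normr0 scale0r addr0; apply; exact: ler01.
have key (a : R) : (a%:E < G w (cinv c z))%E -> ((2 * pi * a)%:E <=
    \int[lebesgue_measure]_(t in `[0%R, (2 * pi)%R]) (G w \o cinv c) (z + circle t *: v)%R)%E.
  move=> az; apply: (sub_mean_of_near (D := cimg c)) => //.
  - exact: cimg_open.
  - by move=> x; exact: G_le0.
  move=> A zA.
  have {}zA : nbhs (cinv c z) (cdom c `&` cmap c @^-1` A).
    have [cz zE] := cinvK Dz.
    apply: filterI; first exact: nbhs_cdom.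
    by apply: (cvg_cmap cz); rewrite zE.
  have [y [cy Ay] ay] := usc_reg_gt az zA.
  exists (cmap c y) => // Dyv.
  have [_ [u [nu lu] <-] au] := ereal_sup_gt ay.
  have [_ _ /(_ _ _ Dyv)] := nu.1 c ac.
  rewrite /= (@cmapK _ _ _ c) ?inE// => mean.
  have pi2 : 0 < 2 * pi :> R by rewrite mulr_gt0// pi_gt0.
  apply: (@le_trans _ _ ((2 * pi)%:E * u y)%E).
    by rewrite EFinM lee_wpmul2l// ?lee_fin ltW.
  apply: (le_trans mean).
  have Dc t : cimg c (cmap c y + circle t *: v) by apply: Dyv; exact: circle_le1.
  apply: le0_le_integral => //.
  - apply: measurable_funTS; have [_ uusc _] := nu.1 c ac.
    by apply: (usc_on_measurable_comp uusc) => //; exact: continuous_circle_line.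
  - apply: measurable_funTS.
    by apply: (usc_on_measurable_comp G_usc) => //; exact: continuous_circle_line.
  - by move=> t; apply: (le_trans _ (le_usc_reg _ _)); exact: le_green.
have pi2 : 0 < 2 * pi :> R by rewrite mulr_gt0// pi_gt0.
move: key; rewrite [(_ \o _) z]/=; case: (G w (cinv c z)) (G_le0 w (cinv c z)) => [r||]// _ key.
  apply: lee_from_reals_lt => b br; rewrite (_ : b = 2 * pi * (b / (2 * pi))).
    by apply: key; move: br; rewrite -EFinM !lte_fin ltr_pdivrMr// mulrC.
  by rewrite mulrC divfK// gt_eqF.
by rewrite gt0_muleNy ?lte_fin// leNye.
Qed.

Let G_log_pole w : log_pole (G w) w.
Proof.
move=> c ac cw; have [C HC] := log_pole_uniform ac cw; exists C.
have c_near := nbhs_cdom cw.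
have gC : \forall z \near w, (green z w <= log_dist c z w + C%:E)%E.
  near=> z; apply: ge_ereal_sup => _ [u [nu lu] <-].
  by have := near HC z; apply.
(* The bound must hold on a whole neighbourhood of each [z], hence the interior; as [log_dist] is
   upper semicontinuous, regularizing does not raise it. *)
have {}gC : nbhs w [set z | (green z w <= log_dist c z w + C%:E)%E]^° by exact: nbhs_interior.
near=> z; apply: lee_from_reals => a.
rewrite -lteBrDr// -EFinB => za; apply: usc_reg_le.
have cz : cdom c z by near: z.
have zint : [set z | (green z w <= log_dist c z w + C%:E)%E]^° z by near: z.
have H := log_dist_lt_near cz za.
near=> y; apply: (@le_trans _ _ (log_dist c y w + C%:E)%E).
  by near: y; exact: zint.
by rewrite -leeBrDr// -EFinB ltW//; near: y.
Unshelve. all: by end_near. Qed.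

Lemma greenE w : (fun z => green z w) = G w.
Proof.
apply/funext => z; apply/le_anti/andP; split; first exact: le_usc_reg.
by apply: le_green; [split; [exact: G_psh|exact: G_le0]|exact: G_log_pole].
Qed.

Lemma green_negative_psh w : negative_psh (fun z => green z w).
Proof. by rewrite greenE; split; [exact: G_psh|exact: G_le0]. Qed.

Lemma green_log_pole w : log_pole (fun z => green z w) w.
Proof. by rewrite greenE; exact: G_log_pole. Qed.

Lemma measurable_green w : measurable_fun [set: borel M] (fun z => green z w).
Proof.
have [pg _] := green_negative_psh w.
by apply: usc_measurable => z a; exact: (psh_usc pg).
Qed.

End green_function.

(** * Biholomorphic invariance *)

Lemma diff_near_id (K : numFieldType) (V : normedModType K) (f : V -> V) (a : V) :
  (\forall x \near a, f x = x) -> 'd f a = idfun :> (V -> V).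
Proof.
move=> fid; apply: diff_unique => [x|]; first exact: cvg_id.
apply/eqaddoP => e e0; near=> x; change (`|f (x + a) - (f a + x)| <= e * `|x|).
have -> : f (x + a) = x + a.
  near: x; have sa : (fun x : V => x + a) @ (0 : V) --> a.
    by rewrite -[X in _ --> X]add0r; apply: cvgD; [exact: cvg_id|exact: cvg_cst].
  exact: sa fid.
have -> : f a = a by exact: nbhs_singleton fid.
by rewrite (addrC a) subrr normr0 mulr_ge0// ltW.
Unshelve. all: by end_near. Qed.

Section biholomorphic_dim.
Context {R : realType}.

(** The coordinate expressions of [F] and [G] compose to the identity near a point. By the chain
    rule the matrices of their differentials satisfy [A *m B = 1], and the rank bounds [m] by [n].
    Used in both directions, this identifies two dimensions that are not assumed equal. *)
Lemma leq_dim_biholomorphic m n (M : complexManifold R m) (N : complexManifold R n)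
    (F : M -> N) (G : N -> M) : cancel F G -> holomorphic F -> holomorphic G -> (m <= n)%N.
Proof.
move=> FG [cF hF] [cG hG].
have [c ac cw] := atlas_cover (point : M); set w := (point : M) in cw.
have [d ad dw] := atlas_cover (F w).
set a := cmap c w; pose f := cmap d \o F \o cinv c; pose g := cmap c \o G \o cinv d.
have wE : cinv c a = w by rewrite /a (@cmapK _ _ _ c)// inE.
have dE : cinv d (cmap d (F w)) = F w by rewrite (@cmapK _ _ _ d)// inE.
have fa : f a = cmap d (F w) by rewrite /f /= wE.
have df : differentiable f a by apply: hF => //; exists w.
have dg : differentiable g (f a).
  by rewrite fa; apply: hG => //; exists (F w) => //; split => //; rewrite /= FG.
have gf : \forall x \near a, (g \o f) x = x.
  have ca : cimg c a by exists w.
  have F_near : nbhs w (F @^-1` cdom d) by apply: cF; exact: nbhs_cdom.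
  rewrite -wE in F_near.
  have d_near := cvg_cinv ca F_near; have c_near := nbhs_cimg ca.
  near=> x; have cx : cimg c x by near: x.
  have dx : cdom d (F (cinv c x)) by near: x; exact: d_near.
  have [_ cxE] := cinvK cx.
  by rewrite /g /f /= (@cmapK _ _ _ d) ?inE// FG cxE.
have gfE v : 'd g (f a) ('d f a v) = v.
  have := diff_near_id gf; rewrite diff_comp// => gfE.
  exact: (congr1 (fun h => h v) gfE).
pose A := lin1_mx ('d f a); pose B := lin1_mx ('d g (f a)).
apply: (@mulmx1_min _ _ _ A B); apply/row_matrixP => i.
by rewrite !rowE mulmxA !mul_rV_lin1 gfE mulmx1.
Unshelve. all: by end_near. Qed.

End biholomorphic_dim.

Section pull_chart.
Context {R : realType} (n : nat) (M N : complexManifold R n).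
Variables (F : M -> N) (G : N -> M).
Hypotheses (FG : cancel F G) (GF : cancel G F).
Hypotheses (hF : holomorphic F) (hG : holomorphic G).

Let pull_img (d : chart R n N) (A : set N) : (cmap d \o F) @` (F @^-1` A) = cmap d @` A.
Proof.
apply/seteqP; split => [_ [x Ax <-]|_ [y Ay <-]]; first by exists (F x).
by exists (G y); rewrite /= GF.
Qed.

Lemma pull_chart_exists (d : chart R n N) : exists c : chart R n M,
  [/\ cdom c = F @^-1` cdom d, cmap c = cmap d \o F & cinv c = G \o cinv d].
Proof.
have [cF _] := hF; have [cG _] := hG.
have oD : open (F @^-1` cdom d) by apply: open_comp => [x _|]; [exact: cF|exact: cdom_open].
have oI : open ((cmap d \o F) @` (F @^-1` cdom d)).
  by rewrite pull_img; exact: cimg_open.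
have K1 : {in F @^-1` cdom d, cancel (cmap d \o F) (G \o cinv d)}.
  by move=> x; rewrite inE => dx; rewrite /= (@cmapK _ _ _ d) ?inE// FG.
have C1 : {in F @^-1` cdom d, continuous (cmap d \o F)}.
  move=> x; rewrite inE => dx; apply: continuous_comp; first exact: cF.
  exact: cvg_cmap.
have C2 : {in (cmap d \o F) @` (F @^-1` cdom d), continuous (G \o cinv d)}.
  move=> x; rewrite pull_img inE => dx; apply: continuous_comp; last exact: cG.
  exact: cvg_cinv.
by exists (Chart oD oI K1 C1 C2).
Qed.

(** Transition maps between the pulled-back chart and a chart of [M] are coordinate expressions of
    [G] and [F], hence holomorphic; maximality of the atlas then admits the chart. *)
Lemma pull_chart_atlas (d : chart R n N) (c : chart R n M) : atlas d ->
  cdom c = F @^-1` cdom d -> cmap c = cmap d \o F -> cinv c = G \o cinv d -> atlas c.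
Proof.
move=> ad cD cM cI; apply: atlas_maximal => e ae; split; rewrite cD cM.
- rewrite (_ : F @^-1` cdom d `&` cdom e = F @^-1` (cdom d `&` G @^-1` cdom e)).
    by rewrite pull_img cI; exact: (hG.2 d e ad ae).
  by apply/seteqP; split => x /= []; rewrite FG.
- by rewrite setIC; exact: (hF.2 e d ae ad).
Qed.

Lemma pull_cimg (d : chart R n N) (c : chart R n M) :
  cdom c = F @^-1` cdom d -> cmap c = cmap d \o F -> cimg c = cimg d.
Proof. by move=> cD cM; rewrite /cimg cD cM pull_img. Qed.

End pull_chart.

Section transport.
Context {R : realType} (n : nat) (M N : complexManifold R n).
Variables (F : M -> N) (G : N -> M).
Hypotheses (FG : cancel F G) (GF : cancel G F).
Hypotheses (hF : holomorphic F) (hG : holomorphic G).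

(* Pushing the chart [c] of [M] forward to [N] turns every computation in [c]
   into the same computation in a chart of [N]. *)
Lemma push_chart (c : chart R n M) : atlas c -> exists d : chart R n N,
  [/\ atlas d, cdom d = G @^-1` cdom c, cmap d = cmap c \o G, cinv d = F \o cinv c
    & cimg d = cimg c].
Proof.
move=> ac; have [d [dD dM dI]] := pull_chart_exists GF FG hG hF c.
exists d; split => //; first exact: (pull_chart_atlas GF FG hG hF ac dD dM dI).
exact: (pull_cimg FG).
Qed.

Lemma psh_comp (u : N -> \bar R) : psh u -> psh (u \o F).
Proof.
move=> pu c ac; have [d [ad dD dM dI dimg]] := push_chart ac.
by have := pu d ad; rewrite dimg dI.
Qed.

Lemma log_pole_comp (u : N -> \bar R) (w : M) : log_pole u (F w) -> log_pole (u \o F) w.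
Proof.
move=> lu c ac cw; have [d [ad dD dM dI dimg]] := push_chart ac.
have dw : cdom d (F w) by rewrite dD /= FG.
have [C HC] := lu d ad dw; exists C.
have {}HC := hF.1 w _ HC; near=> z.
have : (u (F z) <= log_dist d (F z) (F w) + C%:E)%E by near: z; exact: HC.
by rewrite /log_dist dM /= !FG.
Unshelve. all: by end_near. Qed.

Lemma green_le_comp (z w : M) : (green (F z) (F w) <= green z w)%E.
Proof.
apply: ge_ereal_sup => _ [u [[pu u0] lu] <-].
apply: (@le_green _ _ _ (u \o F)); first by split=> [|x]; [exact: psh_comp|exact: u0].
exact: log_pole_comp.
Qed.

End transport.

Lemma green_comp (R : realType) (n : nat) (M N : complexManifold R n) (F : M -> N)
    (G : N -> M) (y : N) (w : M) : cancel F G -> cancel G F -> holomorphic F -> holomorphic G ->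
  green y (F w) = green (G y) w.
Proof.
move=> FG GF hF hG; apply/le_anti/andP; split.
  by rewrite -{1}(GF y); exact: (green_le_comp FG).
by rewrite -{1}(FG w); exact: (green_le_comp GF).
Qed.

(** * Comparison of volume forms *)

Section borel_facts.

Lemma open_borel (T : ptopologicalType) (A : set T) : open A -> measurable (A : set (borel T)).
Proof. by move=> oA; exact: sub_sigma_algebra. Qed.

Lemma open_preimage_within (S T : topologicalType) (D : set S) (f : S -> T) (B : set T) :
  open D -> (forall x, D x -> f @ x --> f x) -> open B -> open (D `&` f @^-1` B).
Proof.
move=> oD cf oB; rewrite openE => x [Dx Bfx]; apply: filterI; first by apply: open_nbhs_nbhs.
by apply: (cf _ Dx); apply: open_nbhs_nbhs.
Qed.

Lemma continuous_on_borel (S T : ptopologicalType) (D : set S) (f : S -> T) : open D ->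
  (forall x, D x -> f @ x --> f x) -> measurable_fun (D : set (borel S)) (f : borel S -> borel T).
Proof.
move=> oD cf mD; have H := @measurability _ _ _ _ (D : set (borel S)) (f : borel S -> borel T) open.
apply: H => // _ [B oB <-]; apply: open_borel; exact: open_preimage_within.
Qed.

Lemma continuous_on_borel_real (R : realType) (S : ptopologicalType) (D : set S) (f : S -> R) :
  open D -> (forall x, D x -> f @ x --> f x) -> measurable_fun (D : set (borel S)) f.
Proof.
move=> oD cf mD; have H := @measurability _ _ _ _ (D : set (borel S)) f _ (RGenOpens.measurableE R).
apply: H => // _ [_ [a [b ->]] <-]; apply: open_borel.
by apply: open_preimage_within => //; exact: interval_open.
Qed.

End borel_facts.

Section compact_neighborhoods.
Context {R : realType}.

Lemma compact_nbhs_Cn n (a : 'rV[Cx R]_n) (A : set 'rV[Cx R]_n) : nbhs a A ->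
  exists B, [/\ compact B, nbhs a B & B `<=` A].
Proof.
move=> /nbhs_ballP[e /Cx_posP[r r0 ->] eA].
have r2 : 0 < r / 2 by rewrite divr_gt0.
have r2C : 0 < ((r / 2)%:C)%C :> Cx R by rewrite (_ : 0 = (0%:C)%C :> Cx R)// ltcR.
pose D i := [set z : Cx R | `|a 0 i - z| <= ((r / 2)%:C)%C].
exists [set v : 'rV[Cx R]_n | forall i, D i (v ord0 i)]; split.
- apply: rV_compact => i.
  rewrite (_ : D i = (fun c : Cx R => a 0 i + c * ((r / 2)%:C)%C) @` [set c : Cx R | `|c| <= 1]).
    apply: continuous_compact; last exact: compact_disc.
    apply: continuous_subspaceT => x.
    apply: (@cvgD _ _ _ (nbhs x) (nbhs_filter x)); first exact: cvg_cst.
    by apply: (@cvgMr_tmp _ _ (nbhs x) (nbhs_filter x)); exact: cvg_id.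
  apply/seteqP; split => [z /= zr|_ [c /= c1 <-]].
    exists ((z - a 0 i) / ((r / 2)%:C)%C); last by rewrite divfK ?gt_eqF// addrC subrK.
    by rewrite normf_div (gtr0_norm r2C) ler_pdivrMr// mul1r distrC.
  by rewrite /D /= opprD addrA subrr add0r normrN normrM (gtr0_norm r2C) ler_piMl// ltW.
- apply/nbhs_ballP; exists ((r / 2)%:C)%C => //= v [_ av] i.
  by rewrite /D /=; apply: ltW; exact: av.
- move=> v Dv; apply: eA; split => [|j i].
    by rewrite (_ : 0 = (0%:C)%C :> Cx R)// ltcR.
  rewrite ord1 /ball/=; apply: (le_lt_trans (Dv i)).
  by rewrite ltcR; lra.
Qed.

End compact_neighborhoods.

Section volume_comparison.
Context {R : realType} (n : nat).

(** The image under the chart is a preimage under its inverse [cinv], which is continuous on the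
    open set [cimg c]. *)
Lemma measurable_cmap_img (M : complexManifold R n) (c : chart R n M) (A : set M) :
  measurable (A : set (borel M)) -> A `<=` cdom c ->
  measurable (cmap c @` A : set (borel 'rV[Cx R]_n)).
Proof.
move=> mA Ac.
rewrite (_ : _ @` _ = cimg c `&` cinv c @^-1` A).
  have := @continuous_on_borel _ _ (cimg c) (cinv c) (@cimg_open _ _ _ c)
    (@cvg_cinv _ _ _ c).
  by apply => //; apply: open_borel; exact: cimg_open.
apply/seteqP; split => [_ [x Ax <-]|x [cx Ax]].
  by split; [exists x => //; exact: Ac|rewrite /= (@cmapK _ _ _ c)// inE; exact: Ac].
by exists (cinv c x) => //; have [] := cinvK cx.
Qed.

Lemma measurable_vdens (M : complexManifold R n) (V : volumeForm M) (c : chart R n M) :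
  atlas c -> measurable_fun (cimg c : set (borel 'rV[Cx R]_n)) (vdens V c).
Proof.
move=> ac; have vc (x : 'rV[Cx R]_n) : cimg c x -> vdens V c @ x --> vdens V c x.
  by move=> cx; apply: (@vdens_continuous _ _ _ V c ac); rewrite inE.
exact: (continuous_on_borel_real (@cimg_open _ _ _ c) vc).
Qed.

Lemma vol_chart_img (M : complexManifold R n) (V : volumeForm M) (c : chart R n M) (A : set M) :
  atlas c -> measurable (A : set (borel M)) -> A `<=` cdom c ->
  vol V A = (\int[lebesgueC n]_(z in cmap c @` A) (vdens V c z)%:E)%E.
Proof. by move=> ac mA; exact: vol_chart. Qed.

Lemma integral_vdens_le (M N : complexManifold R n) (V : volumeForm M) (U : volumeForm N)
    (c : chart R n M) (d : chart R n N) (k : R) (S : set 'rV[Cx R]_n) :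
  atlas c -> atlas d -> 0 <= k -> measurable (S : set (borel 'rV[Cx R]_n)) ->
  S `<=` cimg c -> S `<=` cimg d -> (forall x, S x -> vdens U d x <= k * vdens V c x) ->
  (\int[lebesgueC n]_(z in S) (vdens U d z)%:E <=
    k%:E * \int[lebesgueC n]_(z in S) (vdens V c z)%:E)%E.
Proof.
move=> ac ad k0 mS Sc Sd UV.
have mV : measurable_fun (S : set (borel 'rV[Cx R]_n)) (vdens V c).
  apply: measurable_funS (measurable_vdens V ac) => //.
  by apply: open_borel; exact: cimg_open.
have mU : measurable_fun (S : set (borel 'rV[Cx R]_n)) (vdens U d).
  apply: measurable_funS (measurable_vdens U ad) => //.
  by apply: open_borel; exact: cimg_open.
have V0 x : S x -> (0 <= (vdens V c x)%:E)%E.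
  by move=> Sx; rewrite lee_fin ltW// vdens_gt0//; exact: Sc.
rewrite -ge0_integralZl_EFin//; last exact/measurable_EFinP.
apply: ge0_le_integral => //.
- by move=> x Sx; rewrite lee_fin ltW// vdens_gt0//; exact: Sd.
- exact/measurable_EFinP.
- by apply: measurable_funeM; exact/measurable_EFinP.
Qed.

End volume_comparison.

Section dominated_on.
Context d (T : measurableType d) (R : realType).
Variables (mu nu : {measure set T -> \bar R}).

Definition dominated_on (A : set T) := exists2 k : R, 0 <= k &
  forall B, measurable B -> B `<=` A -> (nu B <= k%:E * mu B)%E.

Lemma dominated_on0 : dominated_on set0.
Proof.
exists 0 => // B mB; rewrite subset0 => ->; by rewrite !measure0 mule0.
Qed.

Lemma dominated_onU (A1 A2 : set T) : measurable A1 -> measurable A2 ->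
  dominated_on A1 -> dominated_on A2 -> dominated_on (A1 `|` A2).
Proof.
move=> mA1 mA2 [k1 k10 H1] [k2 k20 H2]; exists (k1 + k2) => [|B mB BA].
  by rewrite addr_ge0.
have -> : B = (B `&` A1) `|` (B `&` A2) by rewrite -setIUr setIidl.
have m1 : measurable (B `&` A1) by exact: measurableI.
have m2 : measurable (B `&` A2) by exact: measurableI.
apply: (le_trans (measureU2 _ m1 m2)).
rewrite EFinD ge0_muleDl ?lee_fin//; apply: leeD.
  apply: (le_trans (H1 _ m1 _)); first exact: subIsetr.
  by rewrite lee_wpmul2l ?lee_fin// le_measure ?inE//; exact: measurableU.
apply: (le_trans (H2 _ m2 _)); first exact: subIsetr.
by rewrite lee_wpmul2l ?lee_fin// le_measure ?inE//; exact: measurableU.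
Qed.

End dominated_on.

Section exhaustion.
Context {R : realType} (n : nat) (M N : complexManifold R n).
Variables (F : M -> N) (G : N -> M).
Hypotheses (FG : cancel F G) (GF : cancel G F).
Hypotheses (hF : holomorphic F) (hG : holomorphic G).
Variables (V : volumeForm M) (U : volumeForm N).

Lemma holomorphic_measurable m' n' (M' : complexManifold R m') (N' : complexManifold R n')
    (H : M' -> N') : holomorphic H -> measurable_fun setT (H : borel M' -> borel N').
Proof. by move=> [cH _]; apply: continuous_on_borel; [exact: openT|move=> x _; exact: cH]. Qed.

Let mG : measurable_fun setT (G : borel N -> borel M) := holomorphic_measurable hG.

Let UG : {measure set (borel M) -> \bar R} :=
  measure_function_pushforward__canonical__measure_function_Measure (vol U) mG.

Let UGE (A : set (borel M)) : UG A = vol U (G @^-1` A). Proof. by []. Qed.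

(** The chart [d] pushed forward from [c] has the same coordinates, so [V] and the transported [U]
    have densities [p] and [q] against one Lebesgue measure, without a Jacobian. Being continuous
    and positive, these have bounded ratios near [a]. *)
Lemma local_comparison (x : M) : exists A : set M, [/\ nbhs x A, compact (closure A),
  dominated_on (vol V) UG A & dominated_on UG (vol V) A].
Proof.
have [c ac cx] := atlas_cover x; have [d [ad dD dM dI dimg]] := push_chart FG GF hF hG ac.
set a := cmap c x; have ca : cimg c a by exists x.
have xE : cinv c a = x by rewrite /a (@cmapK _ _ _ c)// inE.
pose p := vdens V c; pose q := vdens U d.
have pa0 : 0 < p a by exact: vdens_gt0.
have qa0 : 0 < q a by apply: vdens_gt0 => //; rewrite dimg.
have cp : p @ a --> p a by apply: (@vdens_continuous _ _ _ V c ac); rewrite inE.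
have cq : q @ a --> q a by apply: (@vdens_continuous _ _ _ U d ad); rewrite inE dimg.
(* Near [a], [q] is below [2 * q a] and [p] above [p a / 2], so [q / p < 4 * (q a / p a)]; adding
   the inverse ratio bounds [p / q] as well. *)
pose k := 4 * (q a / p a + p a / q a).
have k0 : 0 <= k by rewrite mulr_ge0// addr_ge0// divr_ge0// ltW.
have pq_near : nbhs a [set y | q y <= k * p y /\ p y <= k * q y].
  have p1 : \forall y \near a, p y < 2 * p a by apply: (cvgr_lt _ cp); lra.
  have p2 : \forall y \near a, p a / 2 < p y by apply: (cvgr_gt _ cp); lra.
  have q1 : \forall y \near a, q y < 2 * q a by apply: (cvgr_lt _ cq); lra.
  have q2 : \forall y \near a, q a / 2 < q y by apply: (cvgr_gt _ cq); lra.
  have key (s t s' t' : R) : 0 < s -> 0 < t -> s' < 2 * s -> t / 2 < t' ->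
      s' <= 4 * (s / t + t / s) * t'.
    move=> s0 t0 ss tt; apply: (@le_trans _ _ (4 * (s / t) * t')).
      have -> : 4 * (s / t) * t' = 2 * s * (t' / (t / 2)) by field; rewrite gt_eqF.
      apply: (le_trans (ltW ss)); rewrite ler_peMr//; first by lra.
      by rewrite ler_pdivlMr ?mul1r ?ltW//; lra.
    rewrite ler_wpM2r//; first by lra.
    by rewrite ler_wpM2l// lerDl divr_ge0// ltW.
  near=> y; split.
    apply: (key (q a) (p a)) => //; near: y => //.
  by rewrite /k [_ / _ + _]addrC; apply: (key (p a) (q a)) => //; near: y.
have [B [cB aB Bsub]] := compact_nbhs_Cn (filterI (nbhs_cimg ca) pq_near).
pose A := cdom c `&` cmap c @^-1` B.
have AB : A `<=` cinv c @` B.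
  by move=> y [cy By]; exists (cmap c y) => //; rewrite (@cmapK _ _ _ c)// inE.
have cK : compact (cinv c @` B).
  apply: continuous_compact => //; apply: continuous_in_subspaceT => y.
  by rewrite inE => /Bsub[cy _]; exact: cvg_cinv.
have kK : closed (cinv c @` B) by apply: compact_closed => //; exact: manifold_hausdorff.
have img (S : set M) : (cmap d @` (G @^-1` S) = cmap c @` S).
  rewrite dM; apply/seteqP; split => [_ [y Sy <-]|_ [y Sy <-]]; first by exists (G y).
  by exists (F y); rewrite /= FG.
have mGS (S : set M) : measurable (S : set (borel M)) -> measurable (G @^-1` S : set (borel N)).
  by move=> mS; rewrite -[X in measurable X]setTI; exact: mG.
have comp (S : set M) : S `<=` A -> measurable (S : set (borel M)) ->
    [/\ UG S = (\int[lebesgueC n]_(z in cmap c @` S) (q z)%:E)%E,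
        vol V S = (\int[lebesgueC n]_(z in cmap c @` S) (p z)%:E)%E,
        measurable (cmap c @` S : set (borel 'rV[Cx R]_n)) &
        forall z, (cmap c @` S) z -> [/\ cimg c z, q z <= k * p z & p z <= k * q z]].
  move=> SA mS; have Sc : S `<=` cdom c by move=> y /SA[].
  split.
  - rewrite UGE (vol_chart_img U ad) ?img//; first exact: mGS.
    by rewrite dD => y /Sc.
  - exact: vol_chart_img.
  - exact: measurable_cmap_img.
  - by move=> _ [y /SA[cy /Bsub [cy' [q1 q2]]] <-].
exists A; split.
- by apply: filterI; [exact: nbhs_cdom|exact: (cvg_cmap cx)].
- apply: (subclosed_compact _ cK); first exact: closed_closure.
  by rewrite ((closure_id _).1 kK); exact: closureS.
- exists k => // S mS SA; have [-> -> mI H] := comp S SA mS.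
  by apply: integral_vdens_le => // y /H[]//; rewrite dimg.
- exists k => // S mS SA; have [-> -> mI H] := comp S SA mS.
  by apply: integral_vdens_le => // y /H[]//; rewrite dimg.
Unshelve. all: by end_near. Qed.

Lemma comparison_exhaustion : exists E : nat -> set M,
  [/\ forall j, open (E j), forall j, compact (closure (E j)), forall j, E j `<=` E j.+1,
      \bigcup_j E j = setT &
      forall j, dominated_on (vol V) UG (E j) /\ dominated_on UG (vol V) (E j)].
Proof.
have [B cB [Bopen Bbasis]] := @manifold_second_countable _ _ M.
pose good (A : set M) := [/\ open A, compact (closure A), dominated_on (vol V) UG A
  & dominated_on UG (vol V) A].
have good0 : good set0.
  split; [exact: open0|rewrite closure0; exact: compact0|exact: dominated_on0|exact: dominated_on0].
have goodU A1 A2 : good A1 -> good A2 -> good (A1 `|` A2).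
  move=> [p1 c1 d1 e1] [p2 c2 d2 e2]; split.
  - exact: openU.
  - by rewrite closureU; exact: compactU.
  - by apply: dominated_onU => //; exact: open_borel.
  - by apply: dominated_onU => //; exact: open_borel.
have /countable_injP[f finj] := cB.
(* The injection [f] numbers the countable basis; [D i] is the good member of number [i], or empty
   if there is none. The unions [E] start empty, so this member enters at stage [i + 1]. *)
pose D i := \bigcup_(A in [set A | [/\ B A, good A & f A = i]]) A.
have Dgood i : good (D i).
  have [[A [BA gA fA]]|no] := pselect (exists A, [/\ B A, good A & f A = i]).
    suff -> : D i = A by [].
    apply/seteqP; split => [y [A' [BA' _ fA'] Ay]|y Ay]; last by exists A.
    by rewrite (finj A A') ?inE// fA fA'.
  suff -> : D i = set0 by [].
  by rewrite -subset0 => y [A HA]; exfalso; apply: no; exists A.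
pose E := fix E (j : nat) : set M := if j is j'.+1 then E j' `|` D j' else set0.
have Egood j : good (E j) by elim: j => [|j IH]//=; exact: goodU.
exists E; split => [j|j|j||j]; try by have [] := Egood j.
- exact: subsetUl.
- apply/seteqP; split => // x _.
  have [A [xA cA dA eA]] := local_comparison x.
  have [A' [BA' A'x] A'A] := Bbasis x A xA.
  exists (f A').+1 => //=; right; exists A' => //; split => //; split.
  + exact: Bopen.
  + apply: (subclosed_compact _ cA); first exact: closed_closure.
    exact: closureS.
  + by have [k k0 H] := dA; exists k => // S mS SA'; apply: H => //; exact: subset_trans A'A.
  + by have [k k0 H] := eA; exists k => // S mS SA'; apply: H => //; exact: subset_trans A'A.
Qed.

End exhaustion.

(** * Positivity and finiteness of the norms of Green functions *)

Lemma ge0_integral_gt0 d (T : measurableType d) (R : realType)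
    (mu : {measure set T -> \bar R}) (D : set T) (f : T -> \bar R) : measurable D ->
  measurable_fun D f -> (forall x, D x -> 0 < f x)%E -> (0 < mu D)%E ->
  (0 < \int[mu]_(x in D) f x)%E.
Proof.
move=> mD mf f0 D0; rewrite lt_neqAle integral_ge0 ?andbT; last first.
  by move=> x Dx; exact/ltW/f0.
rewrite eq_sym; apply/eqP => If0.
have : (\int[mu]_(x in D) `|f x| = 0)%E.
  by rewrite -If0; apply: eq_integral => x; rewrite inE => Dx; rewrite gee0_abs// ltW// f0.
move=> /(ae_eq_integral_abs _ mD mf)[N [mN N0 DN]].
move: D0; rewrite (@subset_measure0 _ _ _ mu D N) ?ltxx// => x Dx.
by apply: DN => /= /(_ Dx) fx; have := f0 _ Dx; rewrite fx ltxx.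
Qed.

Section lebesgueC_positive.
Context {R : realType}.
Local Notation re := (@complex.Re R).
Local Notation im := (@complex.Im R).

(** Boxes in real and imaginary parts are products under [cvec], so the iterated product measure can
    be evaluated on them; the balls of the norm are polydiscs, which contain such boxes. *)
Definition realbox n (a : 'rV[Cx R]_n) (r : R) : set 'rV[Cx R]_n :=
  [set z | forall i, `|re (z 0 i) - re (a 0 i)| < r /\ `|im (z 0 i) - im (a 0 i)| < r].

Lemma measurable_realbox n (a : 'rV[Cx R]_n) r :
  measurable (realbox a r : set (borel 'rV[Cx R]_n)).
Proof.
rewrite (_ : realbox a r = \bigcap_i ([set z | `|re (z 0 i) - re (a 0 i)| < r] `&`
    [set z | `|im (z 0 i) - im (a 0 i)| < r])); last first.
  by apply/seteqP; split => [z H i _|z H i]; [exact: H|exact: (H i I)].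
apply: fin_bigcap_measurable => // i _; apply: measurableI; apply: open_borel; apply: open_strip.
  exact: ReL.
exact: ImL.
Qed.

Lemma lebesgueC_realbox_gt0 n (a : 'rV[Cx R]_n) (r : R) : 0 < r -> (0 < lebesgueC n (realbox a r))%E.
Proof.
move=> r0; elim: n a => [|n IH] a.
  rewrite /= diracE mem_set ?lte01//= => -[]//.
pose a' : 'rV[Cx R]_n := \row_i a 0 (lift ord0 i).
pose I (x : R) : set R := `](x - r), (x + r)[%classic.
have IE (x y : R) : (`|y - x| < r) = (y \in `](x - r), (x + r)[).
  by rewrite in_itv /= ltr_distl.
change (0 < (((lebesgueC n) \x (@lebesgue_measure R)) \x (@lebesgue_measure R))
  (@cvec R n @^-1` realbox a r))%E.
rewrite (_ : _ @^-1` _ = (realbox a' r `*` I (re (a 0 ord0))) `*` I (im (a 0 ord0))); last first.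
  apply/seteqP; split => [[[v x] y] /= H|[[v x] y] /= [[H xr] yr] i].
    have := H ord0; rewrite cvec0 /= !IE => -[Hx Hy]; split=> //; split => // i.
    by have := H (lift ord0 i); rewrite cvecS /a' mxE.
  case: (unliftP ord0 i) => [j ->|->]; last by rewrite cvec0 /= !IE.
  by have := H j; rewrite cvecS /a' mxE.
have mI x : measurable (I x : set (measurableTypeR R)) by exact: measurable_itv.
have muI x : (@lebesgue_measure R (I x) = (r + r)%:E)%E.
  rewrite lebesgue_measure_itv /= lte_fin ifT; last by lra.
  by rewrite -EFinB; congr _%:E; ring.
have mbox := measurable_realbox a' r.
rewrite product_measure1E//=; last exact: measurableX.
have I0 x : (0 < @lebesgue_measure R (I x))%E by rewrite muI lte_fin addr_gt0.
rewrite product_measure1E// mule_gt0//.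
by rewrite mule_gt0//; exact: I0.
Qed.

Lemma lebesgueC_open_gt0 n (A : set 'rV[Cx R]_n) (a : 'rV[Cx R]_n) : open A -> A a ->
  (0 < lebesgueC n A)%E.
Proof.
move=> oA Aa; have /nbhs_ballP[e /Cx_posP[r r0 ->] eA] : nbhs a A.
  by apply: open_nbhs_nbhs.
have r2 : 0 < r / 2 by rewrite divr_gt0.
apply: (lt_le_trans (lebesgueC_realbox_gt0 a r2)).
apply: le_measure; rewrite ?inE; first exact: measurable_realbox.
  exact: open_borel.
move=> z za; apply: eA; split => [|j i].
  by rewrite (_ : 0 = (0%:C)%C :> Cx R)// ltcR.
rewrite ord1 /ball/= ltCx ReB ImB.
have [H1 H2] := za i; rewrite distrC in H1; rewrite distrC in H2.
rewrite -[ltRHS]ger0_norm ?(ltW r0)// -sqrtr_sqr ltr_sqrt ?exprn_gt0//.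
rewrite -[X in X + _]real_normK ?num_real// -[X in _ + X]real_normK ?num_real//.
move: (normr_ge0 (re (a 0 i) - re (z 0 i))) (normr_ge0 (im (a 0 i) - im (z 0 i))) H1 H2.
move: `|_| `|_| => u v; rewrite !expr2; nra.
Qed.

End lebesgueC_positive.

Section green_norm.
Context {R : realType} (n : nat) (M : complexManifold R n).
Implicit Types (V : volumeForm M) (w z : M).

Lemma vol_open_gt0 V (A : set M) (x : M) : open A -> A x -> (0 < vol V A)%E.
Proof.
move=> oA Ax; have [c ac cx] := atlas_cover x.
pose B := A `&` cdom c; have oB : open B by apply: openI => //; exact: cdom_open.
have mB : measurable (B : set (borel M)) by exact: open_borel.
have Bc : B `<=` cdom c by exact: subIsetr.
apply: (@lt_le_trans _ _ (vol V B)); last first.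
  apply: le_measure; rewrite ?inE; [exact: mB|exact: open_borel|exact: subIsetl].
have oI : open (cmap c @` B).
  rewrite (_ : _ @` _ = cimg c `&` cinv c @^-1` B).
    by apply: open_preimage_within => //; [exact: cimg_open|exact: (@cvg_cinv _ _ _ c)].
  apply/seteqP; split => [_ [y By <-]|y [cy By]].
    by split; [exists y => //; exact: Bc|rewrite /= (@cmapK _ _ _ c)// inE; exact: Bc].
  by exists (cinv c y) => //; have [] := cinvK cy.
have Ic : cmap c @` B `<=` cimg c by move=> _ [y /Bc cy <-]; exists y.
rewrite (vol_chart_img V ac mB Bc); apply: ge0_integral_gt0.
- exact: open_borel.
- apply/measurable_EFinP; apply: measurable_funS (measurable_vdens V ac) => //.
  by apply: open_borel; exact: cimg_open.
- by move=> y /Ic cy; rewrite lte_fin; exact: vdens_gt0.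
- by apply: (@lebesgueC_open_gt0 _ _ _ (cmap c x)) => //; exists x.
Qed.

(** The logarithmic pole forces [green z w < -1] on a neighbourhood of [w], and open neighbourhoods
    have positive volume. *)
Lemma green_norm_gt0 V w : (0 < normV V setT (fun z => green z w))%E.
Proof.
have [c ac cw] := atlas_cover w; have [C HC] := green_log_pole ac cw.
have H1 : \forall z \near w, (log_dist c z w < (- 1 - C)%:E)%E.
  by apply: log_dist_lt_near => //; rewrite log_distxx ltNyr.
pose A : set M := [set z | (green z w < (- 1)%:E)%E].
have Aw : nbhs w A.
  near=> z; have H2 : (green z w <= log_dist c z w + C%:E)%E by near: z; exact: HC.
  apply: (le_lt_trans H2); rewrite -lteBrDr// -EFinB; near: z; exact: H1.
have H3 : (0 < vol V A^°)%E.
  apply: (vol_open_gt0 V (open_interior A) (x := w)).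
  exact: Aw.
have mA : measurable (A^° : set (borel M)) by apply: open_borel; exact: open_interior.
have mg := measurable_green w.
apply: (@lt_le_trans _ _ (\int[vol V]_(z in (A^° : set (borel M))) `|green z w|)%E).
  apply: ge0_integral_gt0 => //.
    by apply: measurable_funTS; exact: measurableT_comp.
  move=> z /interior_subset; rewrite /A /= => gz.
  by rewrite lee0_abs ?green_le0// oppe_gt0 (lt_trans gz)// lte_fin ltrN10.
by apply: ge0_subset_integral => //; exact: measurableT_comp.
Unshelve. all: by end_near. Qed.

Lemma green_norm V w : norming V -> (exists z, green z w != -oo%E) ->
  exists2 p : R, 0 < p & normV V setT (fun z => green z w) = p%:E.
Proof.
move=> [Vfin _ _] gw; have := Vfin _ (green_negative_psh w) gw; have := green_norm_gt0 V w.
by case: (normV _ _ _) => [p||]//; rewrite lte_fin => p0 _; exists p.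
Qed.

(** As [Phi] is chosen by [get], a representative must be exhibited: an integrable function is
    finite a.e., and [fine] of the quotient is integrable. *)
Lemma PhiP V w (p : R) : 0 < p -> normV V setT (fun z => green z w) = p%:E ->
  {ae vol V, forall z, (Phi V w z)%:E = (p^-1%:E * green z w)%E}.
Proof.
move=> p0 pE; have cE : ((cV V w)^-1 = p^-1%:E)%E by rewrite /cV pE inver gt_eqF.
have mg := measurable_green w.
have gi : (vol V).-integrable setT (fun z => green z w).
  by apply/integrableP; split => //; rewrite -/(normV V setT _) pE ltry.
have gfin := integrable_ae measurableT gi.
pose f (z : borel M) := fine (p^-1%:E * green z w)%E.
have fE : {ae vol V, forall z, (f z)%:E = (p^-1%:E * green z w)%E}.
  by apply: filterS gfin => z /(_ I) gz; rewrite fineK// fin_numM.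
have [h hf] : exists h : L1 (vol V), ae_eq (vol V) setT h f.
  apply: L1_intro; apply: (le_integrable measurableT _ _ (integrableZl measurableT p^-1 gi)).
    apply/measurable_EFinP; apply: measurableT_comp => //.
    exact: measurable_funeM.
  by move=> z _; rewrite /= /f; case: (_ * _)%E => [r||]//=; exact: leey.
rewrite /Phi cE.
apply: (@getPex _ [set f : L1 (vol V) |
    {ae vol V, forall z, (f z)%:E = (p^-1%:E * green z w)%E}]).
by exists h; apply: filterS2 hf fE => z H1 H2; rewrite H1.
Qed.

End green_norm.

Section pluriGreenian.
Context {R : realType}.

(** In positive dimension the chart holds a point other than [w], here [cmap c w + v] in
    coordinates, and the strict lower bound excludes [-oo] there. This is the condition under which
    norming applies to the Green function. *)
Lemma green_neq_Ny (n : nat) (M : complexManifold R n.+1) (w : M) :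
  locally_uniformly_pluriGreenian M -> exists z, green z w != -oo%E.
Proof.
move=> /(_ w)[c ac [cw [W [oW Wc Ww [C HC]]]]].
have ca : cimg c (cmap c w) by exists w.
have [r r0 rc] := open_enorm (nbhs_cimg ca).
pose e : 'rV[Cx R]_n.+1 := const_mx 1.
have e0 : e != 0.
  by apply/eqP => /rowP/(_ ord0)/eqP; rewrite !mxE oner_eq0.
have en := enorm_gt0 e0; pose v := ((r / enorm e)%:C)%C *: e.
have csR (x : R) : csqnorm ((x%:C)%C : Cx R) = x ^+ 2 by rewrite /csqnorm /= expr0n addr0.
have vr : enorm v = r.
  by rewrite enormZ csR sqrtr_sqr ger0_norm ?divr_ge0 ?ltW// mulfVK// gt_eqF.
have v0 : v != 0.
  by apply/eqP => v0; move: vr; rewrite v0 enorm0 => r0'; move: r0; rewrite -r0' ltxx.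
have /cinvK[cz zE] : cimg c (cmap c w + v) by apply: rc; rewrite vr.
set z := cinv c (cmap c w + v) in cz zE.
have zw : z != w.
  apply: contra_neq v0 => zw; move: zE; rewrite zw.
  by move=> /eqP; rewrite eq_sym -subr_eq0 addrAC subrr add0r => /eqP.
exists z; apply/eqP => gz; have := HC z w cz Ww zw.
by rewrite gz ltNge leNye.
Qed.

(** A chart is injective into a space with one point, so its open domain is [[set x]], which is
    closed as well. *)
Lemma dim0_unique (M : complexManifold R 0) (x y : M) : connected [set: M] -> x = y.
Proof.
move=> cM; have [c ac cx] := atlas_cover x.
have cE : cdom c = [set x].
  apply/seteqP; split => [z cz|z ->//]; apply: (chart_inj cz cx).
  by apply/rowP => -[].
have : [set x] = [set: M].
  apply: cM; first by exists x.
    by exists (cdom c); [exact: cdom_open|rewrite setTI].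
  exists [set x]; last by rewrite setTI.
  by apply: compact_closed; [exact: manifold_hausdorff|exact: compact_set1].
by move=> /seteqP[_ /(_ y I)].
Qed.

End pluriGreenian.

(** * Transfer of Green functions between the two manifolds *)

Section transfer_green.
Context {R : realType} (n : nat) (M N : complexManifold R n).
Variables (F : M -> N) (G : N -> M).
Hypotheses (FG : cancel F G) (GF : cancel G F).
Hypotheses (hF : holomorphic F) (hG : holomorphic G).
Variables (V : volumeForm M) (U : volumeForm N).
Hypotheses (V_norming : norming V) (U_norming : norming U).
Hypothesis M_green : forall w : M, exists z, green z w != -oo%E.

Lemma Phi_transfer : exists T : L1 (vol V) -> L1 (vol U),
  {within closure (range (Phi V)), continuous T} /\ forall w, T (Phi V w) = Phi U (F w).
Proof.
have [E [oE cE ndE bigE EVU]] := comparison_exhaustion FG GF hF hG V U.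
have mE j : measurable (E j : set (borel M)) by exact: open_borel.
have ndE' : nondecreasing_seq E.
  by apply/nondecreasing_seqP => j; rewrite subsetEset; exact: ndE.
have /choice[p pP] (w : M) : exists p : R, 0 < p /\ normV V setT (fun z => green z w) = p%:E.
  by have [p p0 pE] := green_norm V_norming (M_green w); exists p.
have gF y (w : M) : green y (F w) = green (G y) w by exact: green_comp.
have N_green w : exists y, green y (F w) != -oo%E.
  by have [z gz] := M_green w; exists (F z); rewrite gF FG.
have /choice[q qP] (w : M) : exists q : R, 0 < q /\ normV U setT (fun y => green y (F w)) = q%:E.
  by have [q q0 qE] := green_norm U_norming (N_green w); exists q.
pose mG := holomorphic_measurable hG.
pose UG : {measure set (borel M) -> \bar R} :=
  measure_function_pushforward__canonical__measure_function_Measure (vol U) mG.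
have qE w : (\int[vol U]_y `|green (G y) w| = (q w)%:E)%E.
  by rewrite -(qP w).2 /normV; apply: eq_integral => y _; rewrite gF.
have mg (w : M) : measurable_fun [set: borel M] (fun z => green z w) := measurable_green w.
have qE' w : (\int[UG]_z `|green z w| = (q w)%:E)%E.
  by rewrite (ge0_integral_pushforward mG)//; [exact: qE|exact: measurableT_comp].
have /choice[K K_dom] (j : nat) : exists k : R, 0 <= k /\ forall A : set (borel M),
    measurable A -> A `<=` E j -> (UG A <= k%:E * vol V A)%E.
  by have [[k k0 kP] _] := EVU j; exists k.
have /choice[K' K'_dom] (j : nat) : exists k : R, 0 <= k /\ forall A : set (borel M),
    measurable A -> A `<=` E j -> (vol V A <= k%:E * UG A)%E.
  by have [_ [k k0 kP]] := EVU j; exists k.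
have [_ _ /(_ E oE cE ndE bigE)[eps [_ eps0 epsP]]] := V_norming.
have eps_tail w j : (\int[vol V]_(z in ~` E j) `|green z w| <= (eps j * p w)%:E)%E.
  rewrite EFinM -(pP w).2.
  exact: (epsP _ (green_negative_psh w) (M_green w) j).
(* Here the measures are exchanged, so the tails under [V] enter. The resulting [c] bounds [p] by
   [q] and keeps the new norm away from zero on the closure. *)
have [c c0 pcq] := norm_ratio_bounded (mu := UG) (nu := vol V) mE (fun j => (K'_dom j).1)
  (fun j => (K'_dom j).2) mg (fun w => (qP w).1) (fun w => (pP w).1) qE'
  (fun w => (pP w).2) eps0 eps_tail.
(* The tails under [U] are taken along the transported exhaustion of [N]. Its members are images
   under [F] of relatively compact sets, so the norming property of [U] applies to it. *)
have oGE j : open (G @^-1` E j) by apply: open_comp => // x _; exact: hG.1.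
have cGE j : compact (closure (G @^-1` E j)).
  have FGE (A : set M) : G @^-1` A = F @` A.
    apply/seteqP; split => [y Ay|_ [x Ax <-]]; last by rewrite /= FG.
    by exists (G y).
  have cF : compact (F @` closure (E j)).
    apply: continuous_compact => //; apply: continuous_subspaceT => x; exact: hF.1.
  have kF : closed (F @` closure (E j)).
    by apply: compact_closed => //; exact: manifold_hausdorff.
  apply: (subclosed_compact _ cF); first exact: closed_closure.
  rewrite ((closure_id _).1 kF) FGE; apply: closureS.
  by apply: image_subset; exact: subset_closure.
have ndGE j : G @^-1` E j `<=` G @^-1` E j.+1 by move=> y; exact: ndE.
have bigGE : \bigcup_j (G @^-1` E j) = setT by rewrite -preimage_bigcup bigE.
have [_ _ /(_ _ oGE cGE ndGE bigGE)[eps' [_ eps'0 eps'P]]] := U_norming.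
have eps'_tail w j : (\int[vol U]_(y in ~` (G @^-1` E j)) `|green (G y) w| <=
    (eps' j * q w)%:E)%E.
  have := eps'P _ (green_negative_psh (F w)) (N_green w) j.
  rewrite (qP w).2 -EFinM; apply: le_trans; rewrite /normV.
  by under [leRHS]eq_integral do rewrite gF.
have PsiE w : {ae vol U, forall y, (Phi U (F w) y)%:E = ((q w)^-1%:E * green (G y) w)%E}.
  have [B [mB B0 HB]] := PhiP (qP w).1 (qP w).2; exists B; split => // y /= Hy.
  by apply: HB => /= H; apply: Hy; rewrite H gF.
exact: (transfer_exists (mu := vol V) (nu := vol U) mG mE ndE' bigE (fun j => (K_dom j).1)
  (fun j => (K_dom j).2) mg (fun w => (pP w).1) (fun w => (qP w).1) (fun w => (pP w).2)
  qE eps'0 eps'_tail c0 pcq (fun w => PhiP (pP w).1 (pP w).2) PsiE).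
Qed.
End transfer_green.

Theorem theorem6p4 (R : realType) (m n : nat)
    (M : complexManifold R m) (N : complexManifold R n)
    (M_connected : connected [set: M]) (N_connected : connected [set: N])
    (M_Greenian : locally_uniformly_pluriGreenian M)
    (N_Greenian : locally_uniformly_pluriGreenian N)
    (F : M -> N) (F_biholomorphic : biholomorphic F)
    (V : volumeForm M) (U : volumeForm N)
    (V_norming : norming V) (U_norming : norming U) :
  exists Ft : L1 (vol V) -> L1 (vol U),
    homeomorphism_onto (compactification V) (compactification U) Ft /\
    forall w : M, Ft (Phi V w) = Phi U (F w).
Proof.
have [G [FG GF hF hG]] := F_biholomorphic.
have mn : m = n.
  apply/eqP; rewrite eqn_leq (leq_dim_biholomorphic FG hF hG).
  exact: (leq_dim_biholomorphic GF hG hF).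
case: _ / mn N N_connected N_Greenian F F_biholomorphic U U_norming G FG GF hF hG.
case: m M M_connected M_Greenian V V_norming => [|m] M cM gM V nV N cN gN F bF U nU G FG GF hF hG.
(* In dimension zero both manifolds are single points, so both ranges are singletons and constant
   maps serve in both directions. *)
- pose w : M := point; pose T (_ : L1 (vol V)) := Phi U (F w).
  have Mw x : x = w by exact: dim0_unique.
  exists T; split; last by move=> x; rewrite (Mw x).
  apply: (closure_homeomorphism (g := fun=> Phi V w)).
  + exact: metric_hausdorff.
  + exact: metric_hausdorff.
  + exact/continuous_subspaceT/cst_continuous.
  + exact/continuous_subspaceT/cst_continuous.
  + by move=> _ [x _ <-]; split; [exists (F w)|rewrite (Mw x)].
  + move=> _ [y _ <-]; split; first by exists w.
    by rewrite /T -(Mw (G y)) GF.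
have M_green (w : M) := green_neq_Ny w gM.
have N_green (w : N) := green_neq_Ny w gN.
have [T [cT TE]] := Phi_transfer FG GF hF hG nV nU M_green.
have [S [cS SE]] := Phi_transfer GF FG hG hF nU nV N_green.
exists T; split => //; apply: (closure_homeomorphism (g := S)) => //.
- exact: metric_hausdorff.
- exact: metric_hausdorff.
- by move=> _ [w _ <-]; rewrite TE SE FG; split => //; exists (F w).
- by move=> _ [w _ <-]; rewrite SE TE GF; split => //; exists (G w).
Qed.
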